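(* Let $f:\mathbb{R}^n\to\mathbb{R}$ be a Lipschitz function and $x_0\in\mathbb{R}^n$. If $f$ is differentiable at $x_0$, then $\Phi f(x_0)=\{f'(x_0)\}$.
   Context: $\mu$ denotes Lebesgue measure, $\mathrm{co}$ the convex hull, $\mathrm{int}$ the interior, $f'$ the gradient of $f$. The class $\Xi$ (relative to $x_0$) consists of all set-valued mappings $D:\mathbb{R}^n\to 2^{\mathbb{R}^n}$, continuous in the Hausdorff metric, with convex compact images, such that: 1. $x_0\in\mathrm{int}(x+D(x))$ for all $x\in S$, $x\ne x_0$, where $S\subset\mathbb{R}^n$ is a neighborhood of $x_0$; 2. the diameter $d(D(x))$ of $D(x)$ tends to zero as $x\to x_0$ and satisfies $d(D(x))\le k\|x-x_0\|$ for some constant $k$; 3. for some sequence $\varepsilon_i\to+0$, $D$ is constant on each set $\{x:\varepsilon_{2i+1}<\|x-x_0\|<\varepsilon_{2i}\}$ (these sets are called the regions of constancy of $D$); 4. for all $x\in S$, $x\neq x_0$, the boundary of $D(x)$ is defined by a continuously differentiable function of $x$. The sequence $\{\varepsilon_i\}$ and the constant $k$ are arbitrary and may depend on $D$. For $D\in\Xi$ put $\varphi(x)=\frac{1}{\mu(D(x))}\int_{D(x)}f(x+y)\,dy$ (so $\varphi$ depends on $D$) and $$\partial\varphi_D(x_0)=\mathrm{co}\{v\in\mathbb{R}^n : v=\lim_{x_i\to x_0}\varphi'(x_i)\},$$ where the points $x_i$ are taken from the regions of constancy of $D$. The subdifferential of the first order of $f$ at $x_0$ is $$\Phi f(x_0)=\mathrm{co}\bigcup_{D\in\Xi}\partial\varphi_D(x_0).$$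 *)

(* Defs.v *)
From HB Require Import structures.
From mathcomp Require Import all_boot all_order all_algebra.
From mathcomp Require Import all_classical all_reals all_analysis.

Set Implicit Arguments.
Unset Strict Implicit.
Unset Printing Implicit Defensive.

Import Order.TTheory GRing.Theory Num.Theory.
Import numFieldNormedType.Exports.

Local Open Scope classical_set_scope.
Local Open Scope ring_scope.

(* R^n is 'rV[R]_n, with the sigma-algebra generated by the coordinates, which
   in finite dimension is the Borel one. *)
Definition rV_display : measure_display. Proof. exact: default_measure_display. Qed.

Section measurable_rV.
Context {R : realType} {n : nat}.

Definition rV_coord (i : 'I_n) (v : 'rV[R]_n) : measurableTypeR R := v 0 i.

Definition rV_measurable : set (set 'rV[R]_n) := g_sigma_preimage rV_coord.

Let rV_measurable0 : rV_measurable set0.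
Proof. exact: sigma_algebra0. Qed.

Let rV_measurableC A : rV_measurable A -> rV_measurable (~` A).
Proof. exact: sigma_algebraC. Qed.

Let rV_measurable_bigcup (F : (set 'rV[R]_n)^nat) :
  (forall i, rV_measurable (F i)) -> rV_measurable (\bigcup_i (F i)).
Proof. exact: sigma_algebra_bigcup. Qed.

HB.instance Definition _ := @isMeasurable.Build rV_display 'rV[R]_n
  rV_measurable rV_measurable0 rV_measurableC rV_measurable_bigcup.

End measurable_rV.

Lemma measurable_rV_coord (R : realType) (n : nat) (i : 'I_n) :
  measurable_fun [set: 'rV[R]_n] (rV_coord i).
Proof.
move=> _ Y mY; rewrite setTI; apply: sub_sigma_algebra => /=.
rewrite -bigcup_seq/=; exists i => /=; first by rewrite mem_index_enum.
by exists Y => //; rewrite setTI.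
Qed.

Lemma measurable_fun_rVP d (T : measurableType d) (R : realType) (n : nat)
    (f : T -> 'rV[R]_n) :
  (forall i, measurable_fun [set: T] (rV_coord i \o f)) ->
  measurable_fun [set: T] f.
Proof.
move=> mf _ A mA; rewrite setTI.
suff : g_sigma_preimage (fun i => rV_coord i \o f) `<=` measurable.
  rewrite g_sigma_preimage_comp; apply.
  by exists A => //; rewrite setTI.
apply: smallest_sub; first exact: sigma_algebra_measurable.
rewrite -bigcup_seq/=; apply: bigcup_sub => i _ B [C mC <-].
exact: mf.
Qed.

Definition rV_cons (R : realType) (n : nat) (p : measurableTypeR R * 'rV[R]_n) :
  'rV[R]_n.+1 := row_mx (const_mx (p.1 : R) : 'M[R]_1) p.2.

Lemma rV_cons0 (R : realType) (n : nat) (p : measurableTypeR R * 'rV[R]_n) :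
  rV_cons p 0 ord0 = p.1.
Proof.
rewrite (_ : ord0 = lshift n (ord0 : 'I_1)); last exact/val_inj.
by rewrite /rV_cons (@row_mxEl R 1 1 n) mxE.
Qed.

Lemma rV_consS (R : realType) (n : nat) (p : measurableTypeR R * 'rV[R]_n)
    (i : 'I_n) : rV_cons p 0 (lift ord0 i) = p.2 0 i.
Proof.
rewrite (_ : lift ord0 i = rshift 1 i); last exact/val_inj.
by rewrite /rV_cons (@row_mxEr R 1 1 n).
Qed.

Lemma measurable_rV_cons (R : realType) (n : nat) :
  measurable_fun [set: measurableTypeR R * 'rV[R]_n] (@rV_cons R n).
Proof.
apply: measurable_fun_rVP => i.
case: (unliftP ord0 i) => [j|] ->.
  rewrite (_ : _ \o _ = rV_coord j \o snd).
    by apply: measurableT_comp => //; exact: measurable_rV_coord.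
  by apply/funext => p; rewrite /rV_coord /= rV_consS.
rewrite (_ : _ \o _ = fst); first exact: measurable_fst.
by apply/funext => p; rewrite /rV_coord /= rV_cons0.
Qed.

Section lebesgue_rV_succ.
Context {R : realType} {n : nat}.
Variable m : {sigma_finite_measure set 'rV[R]_n -> \bar R}.

Definition lebesgue_rV_succ : set 'rV[R]_n.+1 -> \bar R :=
  pushforward (@lebesgue_measure R \x m)%E (@rV_cons R n).

Let mpush : {measure set 'rV[R]_n.+1 -> \bar R} :=
  measure_function_pushforward__canonical__measure_function_Measure
    (lebesgue_measure \x m)%E (@measurable_rV_cons R n).

Let lebesgue_rV_succ0 : lebesgue_rV_succ set0 = 0%E.
Proof. exact: (measure0 mpush). Qed.

Let lebesgue_rV_succ_ge0 A : (0 <= lebesgue_rV_succ A)%E.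
Proof. exact: (measure_ge0 mpush). Qed.

Let lebesgue_rV_succ_sigma_additive : semi_sigma_additive lebesgue_rV_succ.
Proof. exact: (@measure_semi_sigma_additive _ _ _ mpush). Qed.

HB.instance Definition _ := isMeasure.Build _ _ _ lebesgue_rV_succ
  lebesgue_rV_succ0 lebesgue_rV_succ_ge0 lebesgue_rV_succ_sigma_additive.

Let uncons (v : 'rV[R]_n.+1) : measurableTypeR R * 'rV[R]_n :=
  (v 0 ord0, \row_i v 0 (lift ord0 i)).

Let rV_consK : cancel (@rV_cons R n) uncons.
Proof.
case=> x v; rewrite /uncons rV_cons0; congr pair.
by apply/rowP => i; rewrite mxE rV_consS.
Qed.

Let measurable_uncons : measurable_fun [set: 'rV[R]_n.+1] uncons.
Proof.
apply/measurable_fun_pairP; split.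
  rewrite (_ : _ \o _ = rV_coord ord0) //; exact: measurable_rV_coord.
apply: measurable_fun_rVP => i.
rewrite (_ : _ \o _ = rV_coord (lift ord0 i)); first exact: measurable_rV_coord.
by apply/funext => v; rewrite /rV_coord /= mxE.
Qed.

Let lebesgue_rV_succ_sigma_finite : sigma_finite setT lebesgue_rV_succ.
Proof.
have /sigma_finiteP[F [FT ndF Foo]] := sigma_finiteT (@lebesgue_measure R).
have /sigma_finiteP[G [GT ndG Goo]] := sigma_finiteT m.
exists (fun k => uncons @^-1` (F k `*` G k)).
  rewrite -preimage_bigcup -[LHS](preimage_setT uncons); congr (_ @^-1` _).
  rewrite -setXTT FT GT predeqE => -[x y]; split.
    move=> [/= [i _ Fix] [j _ Gjy]]; exists (maxn i j) => //; split.
    - by move: x Fix; exact/subsetPset/ndF/leq_maxl.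
    - by move: y Gjy; exact/subsetPset/ndG/leq_maxr.
  by move=> [i _ []/= ? ?]; split; exists i.
move=> k; have [mF Fk] := Foo k; have [mG Gk] := Goo k; split.
  by rewrite -[X in measurable X]setTI; apply: measurable_uncons => //; exact: measurableX.
rewrite /lebesgue_rV_succ /pushforward -comp_preimage.
rewrite (_ : uncons \o _ = id); last by apply/funext => p /=; rewrite rV_consK.
by rewrite product_measure1E// lte_mul_pinfty// ge0_fin_numE.
Qed.

HB.instance Definition _ := Measure_isSigmaFinite.Build _ _ _ lebesgue_rV_succ
  lebesgue_rV_succ_sigma_finite.

End lebesgue_rV_succ.

Fixpoint lebesgue_rV (R : realType) (n : nat) :
    {sigma_finite_measure set 'rV[R]_n -> \bar R} :=
  match n with
  | 0 => \d_(0 : 'rV[R]_0)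
  | n'.+1 => lebesgue_rV_succ (lebesgue_rV R n')
  end.

Lemma lebesgue_rV_box (R : realType) (n : nat) (A : 'I_n -> set (measurableTypeR R)) :
  (forall i, measurable (A i)) ->
  lebesgue_rV R n [set v | forall i, A i (v 0 i)] =
  (\prod_(i < n) lebesgue_measure (A i))%E.
Proof.
elim: n A => [|n IH] A mA.
  by rewrite big_ord0 /= diracE mem_set //= => -[].
rewrite big_ord_recl -(IH (fun i => A (lift ord0 i))) //.
rewrite [LHS]/= /lebesgue_rV_succ /pushforward.
rewrite (_ : _ @^-1` _ =
    A ord0 `*` [set v : 'rV[R]_n | forall i, A (lift ord0 i) (v 0 i)]).
  rewrite product_measure1E //.
  rewrite (_ : [set v | _] = \bigcap_(i in [set: 'I_n]) (rV_coord i @^-1` A (lift ord0 i))).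
    apply: fin_bigcap_measurable => // i _.
    by rewrite -[X in measurable X]setTI; exact: measurable_rV_coord.
  by apply/seteqP; split => [v vA i _|v vA i]; exact: vA.
apply/seteqP; split => [p /= pA|p /= [p0 pS] i].
  split => [|i]; first by rewrite -rV_cons0; exact: pA.
  by rewrite -rV_consS; exact: pA.
by case: (unliftP ord0 i) => [j|] ->; rewrite ?rV_cons0 ?rV_consS.
Qed.

(* The norm of the library on 'rV[R]_n is the sup norm. *)
Definition enorm (R : realType) (n : nat) (v : 'rV[R]_n) : R :=
  Num.sqrt (\sum_i v 0 i ^+ 2).

Definition lipschitz_rV (R : realType) (n : nat) (f : 'rV[R]_n -> R) : Prop :=
  exists L : R, forall x y, `|f x - f y| <= L * enorm (x - y).

Definition gradient (R : realType) (n : nat) (f : 'rV[R]_n.+1 -> R)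
  (x : 'rV[R]_n.+1) : 'rV[R]_n.+1 := \row_i 'D_(delta_mx 0 i) f x.

Definition convex_hull (R : realType) (n : nat) (A : set 'rV[R]_n) :
  set 'rV[R]_n := smallest (@convex_set R 'rV[R]_n) A.

Definition boundary (T : topologicalType) (A : set T) : set T :=
  closure A `\` A°.

Section metric.
Context {R : realType} {n : nat}.
Implicit Types A B : set 'rV[R]_n.

Definition diameter A : R := sup [set enorm (p.1 - p.2) | p in A `*` A].

Definition dist_set (x : 'rV[R]_n) A : R := inf [set enorm (x - a) | a in A].

Definition excess A B : R := sup [set dist_set a B | a in A].

(* This is the Hausdorff distance when A and B are nonempty and bounded. *)
Definition hausdorff_dist A B : R := Num.max (excess A B) (excess B A).

End metric.

(* {eps_i} is indexed from 0; the i-th region of constancy is the open annulus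
   of radii eps_(2i+1) and eps_(2i), empty unless eps_(2i+1) < eps_(2i). *)
Definition region (R : realType) (n : nat) (x0 : 'rV[R]_n) (eps : R^nat)
    (i : nat) : set 'rV[R]_n :=
  [set x | eps (2 * i).+1 < enorm (x - x0) < eps (2 * i)%N].

(* The boundaries of the D x, for x in S distinct from x0, are parametrized by
   the unit sphere, through a map g that is C^1 in x: the derivative 'J of
   x |-> g x u exists and, like g, is continuous in (x, u). *)
Definition C1_boundary (R : realType) (n : nat) (S : set 'rV[R]_n.+1)
    (x0 : 'rV[R]_n.+1) (D : 'rV[R]_n.+1 -> set 'rV[R]_n.+1) : Prop :=
  let S0 := [set x | S x /\ x != x0] in
  let sphere := [set u : 'rV[R]_n.+1 | enorm u = 1] in
  exists g : 'rV[R]_n.+1 -> 'rV[R]_n.+1 -> 'rV[R]_n.+1,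
    [/\ forall x, S0 x -> boundary (D x) = g x @` sphere,
        {within S0 `*` sphere, continuous (fun p => g p.1 p.2)},
        forall x u, S0 x -> sphere u -> differentiable (fun z => g z u) x
      & {within S0 `*` sphere,
           continuous (fun p => 'J (fun z => g z p.2) p.1)}].

(* D belongs to the class Xi relative to x0 and S, with eps as the sequence
   defining its regions of constancy. *)
Record Xi (R : realType) (n : nat) (S : set 'rV[R]_n.+1) (x0 : 'rV[R]_n.+1)
    (D : 'rV[R]_n.+1 -> set 'rV[R]_n.+1) (eps : R^nat) : Prop := {
  Xi_nonempty : forall x, D x !=set0;
  Xi_convex : forall x, @convex_set R 'rV[R]_n.+1 (D x);
  Xi_compact : forall x, compact (D x);
  Xi_continuous : forall x, hausdorff_dist (D z) (D x) @[z --> x] --> (0 : R);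
  Xi_interior : forall x, S x -> x != x0 -> [set x + y | y in D x]° x0;
  Xi_diameter_cvg : diameter (D x) @[x --> x0^'] --> (0 : R);
  Xi_diameter_le : exists k : R, forall x, diameter (D x) <= k * enorm (x - x0);
  Xi_eps_gt0 : forall i, 0 < eps i;
  Xi_eps_cvg : eps i @[i --> \oo] --> (0 : R);
  Xi_constant : forall i x y, region x0 eps i x -> region x0 eps i y ->
    D x = D y;
  Xi_boundary : C1_boundary S x0 D }.

Definition mean_value (R : realType) (n : nat) (f : 'rV[R]_n -> R)
    (D : 'rV[R]_n -> set 'rV[R]_n) (x : 'rV[R]_n) : R :=
  (fine (lebesgue_rV R n (D x)))^-1 *
  \int[lebesgue_rV R n]_(y in D x) f (x + y).

(* The library's derivative is total, hence the explicit differentiability. *)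
Definition dphi (R : realType) (n : nat) (f : 'rV[R]_n.+1 -> R)
    (x0 : 'rV[R]_n.+1) (D : 'rV[R]_n.+1 -> set 'rV[R]_n.+1) (eps : R^nat) :
    set 'rV[R]_n.+1 :=
  convex_hull [set v | exists x : nat -> 'rV[R]_n.+1,
    [/\ forall j, exists i, region x0 eps i (x j),
        forall j, differentiable (mean_value f D) (x j),
        x j @[j --> \oo] --> x0
      & gradient (mean_value f D) (x j) @[j --> \oo] --> v]].

Definition Phi (R : realType) (n : nat) (S : set 'rV[R]_n.+1)
    (f : 'rV[R]_n.+1 -> R) (x0 : 'rV[R]_n.+1) : set 'rV[R]_n.+1 :=
  convex_hull (\bigcup_(De in [set De | Xi S x0 De.1 De.2])
    dphi f x0 De.1 De.2).

(* Main.v *)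
(* In a region of constancy D is a fixed convex body A; writing s = |x - x0|,
   condition 1 on the sphere of radius s around x0 and convexity put B(0, s)
   inside A, while diam A <= k s.  So A is not thin: it contains
   (1 - |h|/r) A + h for |h| < r ~ s, and therefore translating A by h changes
   the integral of a function g by at most O(|h|/s) mu(A) sup |g|.  Applied to
   the remainder g = f - f(x0) - f'(x0)(. - x0), which is o(s) on x + A, this
   gives phi'(x) - f'(x0) = o(1), so that dphi is contained in {f'(x0)}.

   It remains to see that Phi is not empty.  Take D(x) = the cube of half-side
   rho(|x - x0|), with rho' proportional to the positive part of sin(ln s), so
   that rho is C^1, comparable to s, and constant on infinitely many intervals
   accumulating at 0.  The average of a Lipschitz function over a translated
   cube is differentiable, because its increments are integrals over thin
   slabs, i.e. up to a quadratic error over two opposite faces. *)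

Require Import Defs.
From mathcomp Require Import all_boot all_order all_algebra.
From mathcomp Require Import all_classical all_reals all_analysis.
From mathcomp Require Import measurable_realfun.
From mathcomp Require Import ring lra.
Import Order.TTheory GRing.Theory Num.Theory.
Import numFieldNormedType.Exports.
Local Open Scope classical_set_scope.
Local Open Scope ring_scope.

Set Implicit Arguments.
Unset Strict Implicit.
Unset Printing Implicit Defensive.

(** * Affine changes of variables *)

(** Two norms coexist: the regions and the class Xi are Euclidean, while the product measure and the
    norm of ['rV[R]_n] favour sup-norm cubes; each passage between them costs a factor [n], harmless
    since only orders of magnitude matter. The measure is handled through diagonal affine maps
    alone, obtained from uniqueness on boxes: translations and homotheties serve the convex body,
    and one-coordinate stretches bring a slab of thickness [t] to unit thickness, so that no surface
    integral has to be defined. In the inclusion the differentiability of the mean is given by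
    [dphi]; it has to be proved only for the witness. The logarithm makes [rho] self-similar under
    multiplication of [s] by [exp (-2 pi)]: one constant bounds [rho(s) / s] from below at all
    scales, and a final factor pushes this bound above 1, which is what puts [x0] in the interior of
    [x + D x]. *)

Lemma rV_coord_le_norm (R : realType) (n : nat) (v : 'rV[R]_n) i : `|v 0 i| <= `|v|.
Proof.
rewrite [leRHS]/Num.norm /= mx_normrE.
by apply: (le_trans _ (le_bigmax _ _ (0, i))).
Qed.

Lemma rV_norm_le (R : realType) (n : nat) (v : 'rV[R]_n) r :
  0 <= r -> (forall i, `|v 0 i| <= r) -> `|v| <= r.
Proof.
move=> r0 vr; rewrite [leLHS]/Num.norm /= mx_normrE.
by apply/bigmax_leP; split => // -[j i] _ /=; rewrite ord1.
Qed.

Lemma norm_delta_rV (R : realType) (n : nat) (j : 'I_n) : `|delta_mx 0 j : 'rV[R]_n| <= 1.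
Proof.
apply: rV_norm_le => // l; rewrite mxE eqxx /=.
by case: eqP => _; rewrite ?normr1 ?normr0.
Qed.

Lemma cvg_matrix (R : realType) (T : Type) (F : set_system T) (FF : Filter F) (m n : nat)
    (f : T -> 'M[R]_(m, n)) (A : 'M[R]_(m, n)) :
  (forall i j, f x i j @[x --> F] --> A i j) -> f @ F --> A.
Proof.
move=> fA; apply/cvg_ballP => e e0.
have : \forall x \near F, forall ij : 'I_m * 'I_n, ball (A ij.1 ij.2) e (f x ij.1 ij.2).
  by apply: filter_forall => -[i j]; exact: (cvg_ball (fA i j)).
by apply: filterS => x H; split => // i j; exact: (H (i, j)).
Qed.

Lemma measurable_box (R : realType) (n : nat) (B : 'I_n -> set (measurableTypeR R)) :
  (forall i, measurable (B i)) ->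
  measurable [set v : 'rV[R]_n | forall i, B i (v 0 i)].
Proof.
move=> mB.
rewrite (_ : [set v | _] = \bigcap_(i in [set: 'I_n]) (@rV_coord R n i @^-1` B i)).
  apply: fin_bigcap_measurable => // i _.
  by rewrite -[X in measurable X]setTI; exact: measurable_rV_coord.
by apply/seteqP; split => [v vA i _|v vA i]; exact: vA.
Qed.

(** The rescaled image measure agrees with Lebesgue measure on half-open intervals, which determine
    it. *)
Lemma lebesgue_measure_affine (R : realType) (c b : R) (A : set (measurableTypeR R)) :
  0 < c -> measurable A ->
  (c%:E * @lebesgue_measure R ((fun x => (c * x + b)%R : measurableTypeR R) @^-1` A) =
   lebesgue_measure A)%E.
Proof.
move=> c0 mA.
have mphi : measurable_fun [set: measurableTypeR R] (fun x => c * x + b : measurableTypeR R).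
  by apply: measurable_funD => //; apply: measurable_funM.
pose m := measure_function_pushforward__canonical__measure_function_Measure (@lebesgue_measure R) mphi.
pose c' := NngNum (ltW c0).
pose m2 : {measure set _ -> \bar R} := mscale c' m.
rewrite -[LHS]/(m2 A).
apply/esym/lebesgue_measure_unique => //= _ [[u v]] _ <-.
rewrite /= /mscale /= /pushforward /=.
rewrite (_ : _ @^-1` _ = `](u - b) / c, (v - b) / c]%classic); last first.
  apply/seteqP; split => x /=; rewrite !in_itv/= ltr_pdivrMr// ler_pdivlMr// ltrBlDr lerBrDr mulrC //.
rewrite !lebesgue_measure_itv/= !lte_fin ltr_pM2r ?invr_gt0// ltrD2r.
case: ifPn => _; last by rewrite mule0.
by rewrite -!EFinB -EFinM -mulrBl mulrCA divff ?gt_eqF// mulr1 opprB addrA subrK.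
Qed.

(** Boxes are stable under intersection, generate the sigma-algebra and include an exhaustion by
    sets of finite measure. This reduces changes of variables to dimension one. *)
Lemma lebesgue_rV_unique (R : realType) (n : nat) (m : {measure set 'rV[R]_n -> \bar R}) :
  (forall B : 'I_n -> set (measurableTypeR R), (forall i, measurable (B i)) ->
     m [set v | forall i, B i (v 0 i)] = (\prod_(i < n) lebesgue_measure (B i))%E) ->
  forall A, measurable A -> m A = lebesgue_rV R n A.
Proof.
move=> mE A mA; apply/esym.
pose G := [set [set v : 'rV[R]_n | forall i, B i (v 0 i)] |
  B in [set B : 'I_n -> set (measurableTypeR R) | forall i, measurable (B i)]].
pose g k := [set v : 'rV[R]_n | forall i, `]-(k%:R), k%:R]%classic (v 0 i : measurableTypeR R)].
apply: (@measure_unique _ _ _ G g) => //.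
- apply/seteqP; split.
    apply: smallest_sub; first exact: smallest_sigma_algebra.
    rewrite -bigcup_seq/=; apply: bigcup_sub => i _ B [C mC <-].
    (* A cylinder over one coordinate is a box whose other sides are the whole line. *)
    apply: sub_sigma_algebra; exists (fun j => if j == i then C else setT).
      by move=> j; case: ifP.
    rewrite setTI; apply/seteqP; split => [v /(_ i)|v vC j /=]; first by rewrite eqxx.
    by case: ifPn => // /eqP ->.
  apply: smallest_sub; first exact: sigma_algebra_measurable.
  by move=> _ [B mB <-]; exact: measurable_box.
- move=> _ _ [B mB <-] [C mC <-]; exists (fun i => B i `&` C i).
    by move=> i; apply: measurableI.
  by apply/seteqP; split => [v vBC|v [vB vC] i]; [split => i; have [] := vBC i | split].
- by move=> k; exists (fun i => `]-(k%:R), k%:R]%classic).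
- apply/seteqP; split => // v _.
  have [k kv] : exists k : nat, `|v| < k%:R.
    by exists (Num.truncn `|v|).+1; rewrite truncnS_gt.
  exists k => // i /=; rewrite in_itv /=.
  have : `|v 0 i| < k%:R.
    by apply: le_lt_trans kv; exact: rV_coord_le_norm.
  by rewrite ltr_norml => /andP[-> /ltW ->].
- by move=> _ [B mB <-]; rewrite mE //; exact: lebesgue_rV_box.
- move=> k.
  rewrite [X in (X < _)%E](_ : _ = \prod_(i < n) @lebesgue_measure R (`](-(k%:R))%R, k%:R%R]%classic))%E;
    last first.
    exact: (@lebesgue_rV_box R n (fun=> `]-(k%:R), k%:R]%classic)).
  rewrite -ge0_fin_numE; last first.
    by apply: (big_ind (fun x => 0 <= x)%E) => // *; exact: mule_ge0.
  apply: (big_ind (fun x => x \is a fin_num)) => //=; first exact: fin_numM.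
  by move=> i _; rewrite lebesgue_measure_itv; case: ifP.
Qed.

(** The linear part is diagonal, so boxes pull back to boxes. The instances used are translations,
    homotheties and stretches of a single coordinate. *)
Definition affine_rV (R : realType) (n : nat) (c b v : 'rV[R]_n) : 'rV[R]_n :=
  \row_i (c 0 i * v 0 i + b 0 i).

Lemma measurable_affine_rV (R : realType) (n : nat) (c b : 'rV[R]_n) :
  measurable_fun [set: 'rV[R]_n] (affine_rV c b).
Proof.
apply: measurable_fun_rVP => i.
rewrite (_ : _ \o _ = (fun v => c 0 i * rV_coord i v + b 0 i : measurableTypeR R)).
  by apply: measurable_funD => //; apply: measurable_funM => //; exact: measurable_rV_coord.
by apply/funext => v; rewrite /= /rV_coord mxE.
Qed.

Lemma prode_EFin (R : realType) (I : Type) (r : seq I) (P : pred I) (F : I -> R) :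
  (\prod_(i <- r | P i) (F i)%:E = (\prod_(i <- r | P i) F i)%:E)%E.
Proof. by apply: (big_ind2 (fun x y => x = y%:E)) => // a b c d -> ->; rewrite EFinM. Qed.

Lemma lebesgue_rV_affine (R : realType) (n : nat) (c b : 'rV[R]_n) (A : set 'rV[R]_n) :
  (forall i, 0 < c 0 i) -> measurable A ->
  ((\prod_i c 0 i)%:E * lebesgue_rV R n (affine_rV c b @^-1` A) = lebesgue_rV R n A)%E.
Proof.
move=> c0 mA.
pose m := measure_function_pushforward__canonical__measure_function_Measure (lebesgue_rV R n) (@measurable_affine_rV R n c b).
have p0 : 0 <= \prod_i c 0 i by apply: prodr_ge0 => i _; exact: ltW.
pose m2 : {measure set _ -> \bar R} := mscale (NngNum p0) m.
rewrite -[LHS]/(m2 A); apply: lebesgue_rV_unique => // B mB.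
rewrite /m2/= /mscale/= /pushforward.
pose C i := (fun x : measurableTypeR R => c 0 i * x + b 0 i : measurableTypeR R) @^-1` B i.
have mC i : measurable (C i).
  rewrite -[X in measurable X]setTI.
  have : measurable_fun [set: measurableTypeR R] (fun x => c 0 i * x + b 0 i : measurableTypeR R).
    by apply: measurable_funD => //; apply: measurable_funM.
  by apply.
transitivity ((\prod_i c 0 i)%:E * \prod_(i < n) lebesgue_measure (C i))%E.
  congr (_ * _)%E; rewrite -(lebesgue_rV_box mC); congr (lebesgue_rV R n _).
  by apply/seteqP; split => v /= Bv i; have := Bv i; rewrite /C /= mxE.
rewrite -prode_EFin -big_split /=; apply: eq_bigr => i _.
exact: lebesgue_measure_affine.
Qed.

Lemma measurable_rV_ball (R : realType) (n : nat) (q : 'rV[R]_n) (e : R) :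
  measurable [set v : 'rV[R]_n | forall i, `|v 0 i - q 0 i| < e].
Proof.
rewrite (_ : [set v | _] = \bigcap_(i in [set: 'I_n]) (@rV_coord R n i @^-1` ball (q 0 i : R) e)).
  apply: fin_bigcap_measurable => // i _.
  rewrite -[X in measurable X]setTI; apply: measurable_rV_coord => //.
  exact: measurable_ball.
by apply/seteqP; split => [v vA i _|v vA i]; [have := vA i|have := vA i I];
  rewrite /= /rV_coord -ball_normE /= distrC.
Qed.

(** An open set is the union of those cubes with rational centre and radius [1/(k+1)] that it
    contains, and these are countably many. *)
Lemma open_measurable_rV (R : realType) (n : nat) (A : set 'rV[R]_n) :
  open A -> measurable A.
Proof.
move=> oA.
pose B (p : 'rV[rat]_n * nat) : set 'rV[R]_n :=
  [set v | forall i, `|v 0 i - (map_mx ratr p.1 : 'rV[R]_n) 0 i| < p.2.+1%:R^-1].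
(* Cubes that leave [A] are replaced by the empty set, so that the union runs over a whole countable
   type. *)
pose F p := if `[< B p `<=` A >] then B p else set0.
rewrite (_ : A = \bigcup_p F p).
  apply: countable_bigcupT_measurable => // p; rewrite /F.
  by case: ifP => // _; exact: measurable_rV_ball.
apply/seteqP; split => [v Av|v [p _]]; last first.
  by rewrite /F; case: asboolP => // BA /BA.
have /nbhs_ballP[e /= e0 eA] : nbhs v A by exact: open_nbhs_nbhs.
(* Half of [e] for the distance from [v] to the rational centre, half for the radius of the cube. *)
have e20 : 0 < e / 2 by rewrite divr_gt0.
have [k ke] : exists k, k.+1%:R^-1 < e / 2.
  have := near_infty_natSinv_lt (PosNum e20).
  by move=> [N _ /(_ N (leqnn _))]; exists N.
have /choice[q qv] : forall i, exists q, `|v 0 i - ratr q| < k.+1%:R^-1.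
  move=> i; have : v 0 i - k.+1%:R^-1 < v 0 i by rewrite ltrBlDr ltrDl invr_gt0.
  move=> /rat_in_itvoo[q]; rewrite in_itv /= => /andP[q1 q2]; exists q.
  by rewrite ger0_norm ?subr_ge0 ?(ltW q2)// ltrBlDr -ltrBlDl.
exists ((\row_i q i), k) => //; rewrite /F; case: asboolP; last first.
  case => w Bw; apply: eA; split => // j i; rewrite ord1.
  rewrite -ball_normE /=.
  rewrite -(subrK (ratr (q i)) (v 0 i)) -addrA (le_lt_trans (ler_normD _ _))//.
  rewrite (splitr e) ltrD//; first exact: lt_trans (qv i) ke.
  by rewrite distrC (lt_trans _ ke)//; have := Bw i; rewrite !mxE.
by move=> _ i; rewrite !mxE.
Qed.

Lemma closed_measurable_rV (R : realType) (n : nat) (A : set 'rV[R]_n) :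
  closed A -> measurable A.
Proof. by move/closed_openC/open_measurable_rV/measurableC; rewrite setCK. Qed.

Lemma continuous_measurable_rV (R : realType) (n : nat) (f : 'rV[R]_n -> R) :
  continuous f -> measurable_fun [set: 'rV[R]_n] (f : 'rV[R]_n -> measurableTypeR R).
Proof.
move=> /continuousP cf; apply: (measurability _ (RGenOpens.measurableE R)).
move=> _ [_ [a [b ->] <-]]; rewrite setTI; apply: open_measurable_rV.
exact/cf/interval_open.
Qed.

(** * Cubes and integration over bounded sets *)

Definition cube (R : realType) (n : nat) (r : R) : set 'rV[R]_n := [set v | `|v| <= r].
Arguments cube {R} n r.

Lemma closed_cube (R : realType) (n : nat) (r : R) : closed (cube n r).
Proof.
rewrite (_ : cube n r = (fun v : 'rV[R]_n => `|v|) @^-1` [set x | x <= r]) //.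
by apply: preimage_closed; [move=> v _; exact: norm_continuous | exact: closed_le].
Qed.

Lemma compact_cube (R : realType) (n : nat) (r : R) : compact (cube n r).
Proof.
apply: bounded_closed_compact; last exact: closed_cube.
by exists r; split; [exact: num_real | move=> x rx v /= /le_trans -> //; exact: ltW].
Qed.

Lemma lebesgue_cube (R : realType) (n : nat) (r : R) : 0 <= r ->
  lebesgue_rV R n (cube n r) = ((r *+ 2) ^+ n)%:E.
Proof.
move=> r0.
transitivity (\prod_(i < n) @lebesgue_measure R `[(-r)%R, r]%classic)%E.
  rewrite -lebesgue_rV_box //; congr (lebesgue_rV R n _).
  apply/seteqP; split => v /=.
    by move=> vr i; rewrite in_itv /= -ler_norml; apply: le_trans vr; exact: rV_coord_le_norm.
  by move=> vr; apply: rV_norm_le => // i; have := vr i; rewrite in_itv /= -ler_norml.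
rewrite lebesgue_measure_itv /= lte_fin.
under eq_bigr => i _.
  rewrite (_ : (if _ then _ else _) = (r *+ 2)%:E); first over.
  case: ifPn; first by rewrite -EFinB opprK -mulr2n.
  rewrite -leNgt => rr; have -> : r = 0 by lra.
  by rewrite mul0rn.
by rewrite prode_EFin prodr_const card_ord.
Qed.

Lemma lebesgue_rV_bounded (R : realType) (n : nat) (D : set 'rV[R]_n) (M : R) :
  measurable D -> D `<=` cube n M -> (lebesgue_rV R n D < +oo)%E.
Proof.
move=> mD DM.
apply: (@le_lt_trans _ _ (lebesgue_rV R n (cube n `|M|))).
  apply: le_measure; rewrite ?inE //; first by apply: closed_measurable_rV; exact: closed_cube.
  by move=> v /DM /le_trans; apply; exact: ler_norm.
by rewrite lebesgue_cube // ltry.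
Qed.

Lemma integrable_rV (R : realType) (n : nat) (D : set 'rV[R]_n) (M : R) (f : 'rV[R]_n -> R) :
  measurable D -> D `<=` cube n M -> continuous f ->
  (lebesgue_rV R n).-integrable D (EFin \o f).
Proof.
move=> mD DM cf.
have mf : measurable_fun [set: 'rV[R]_n] (f : 'rV[R]_n -> measurableTypeR R).
  exact: continuous_measurable_rV.
apply: measurable_bounded_integrable => //; first exact: lebesgue_rV_bounded DM.
  exact: measurable_funTS.
have : compact (f @` cube n M).
  apply: continuous_compact; last exact: compact_cube.
  exact: continuous_subspaceT.
move=> /compact_bounded[N [Nr NM]]; exists N; split => // x Nx v /DM vM.
by apply: (NM x Nx); exists v.
Qed.

(** By [lebesgue_rV_affine] Lebesgue measure is a multiple of its own image, so nonnegative
    functions are integrated against an image measure; positive and negative parts then give the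
    general case. *)
Lemma Rintegral_rV_affine (R : realType) (n : nat) (c b : 'rV[R]_n) (D : set 'rV[R]_n)
    (f : 'rV[R]_n -> R) :
  (forall i, 0 < c 0 i) -> measurable D -> continuous f ->
  (lebesgue_rV R n).-integrable (affine_rV c b @^-1` D) (EFin \o (f \o affine_rV c b)) ->
  \int[lebesgue_rV R n]_(y in D) f y =
  (\prod_i c 0 i) * \int[lebesgue_rV R n]_(y in affine_rV c b @^-1` D) f (affine_rV c b y).
Proof.
move=> c0 mD cf intf.
have mf : measurable_fun [set: 'rV[R]_n] (f : 'rV[R]_n -> measurableTypeR R).
  exact: continuous_measurable_rV.
have mT := @measurable_affine_rV R n c b.
have mTD : measurable (affine_rV c b @^-1` D).
  by rewrite -[X in measurable X]setTI; exact: mT.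
pose m := measure_function_pushforward__canonical__measure_function_Measure (lebesgue_rV R n) mT.
have p0 : 0 <= \prod_i c 0 i by apply: prodr_ge0 => i _; exact: ltW.
pose m2 : {measure set _ -> \bar R} := mscale (NngNum p0) m.
have key (g : 'rV[R]_n -> \bar R) : measurable_fun D g -> (forall x, D x -> 0 <= g x)%E ->
   (\int[lebesgue_rV R n]_(y in D) g y =
    (\prod_i c 0%R i)%:E * \int[lebesgue_rV R n]_(y in affine_rV c b @^-1` D) (g \o affine_rV c b) y)%E.
  move=> mg g0.
  rewrite (@eq_measure_integral _ _ _ _ m2); last first.
    by move=> A mA _; exact/esym/lebesgue_rV_affine.
  rewrite ge0_integral_mscale //=; congr (_ * _)%E.
  apply: (ge0_integral_pushforward mT) => //.
  by move=> y; rewrite inE; exact: g0.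
rewrite /Rintegral -[X in X * _]/(fine (\prod_i c 0 i)%:E) -fineM //; last first.
  exact: (integrable_fin_num mTD intf).
congr fine; rewrite integralE [in RHS]integralE.
have mfE : measurable_fun D (EFin \o f) by apply/measurable_EFinP; exact: measurable_funTS.
rewrite !key //; last 2 first.
- exact: measurable_funeneg.
- exact: measurable_funepos.
(* Distributing over the difference requires one term to be finite: this is where integrability
   enters. *)
rewrite -muleBr //; last first.
  apply: fin_num_adde_defr.
  have := integrable_pos_fin_num mTD intf.
  by rewrite (_ : EFin \o (f \o affine_rV c b) = (EFin \o f) \o affine_rV c b) // funepos_comp.
congr (_ * (_ - _))%E; apply: eq_integral => v _.
  exact: (esym (congr1 (@^~ v) (funepos_comp (EFin \o f) (affine_rV c b)))).
exact: (esym (congr1 (@^~ v) (funeneg_comp (EFin \o f) (affine_rV c b)))).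
Qed.

(** * Translation estimate for averages over convex bodies *)

Lemma convex_set_comb (R : realType) (n : nat) (D : set 'rV[R]_n) x y (t : R) :
  @convex_set R 'rV[R]_n D -> D x -> D y -> 0 <= t -> t <= 1 ->
  D (t *: x + (1 - t) *: y).
Proof.
move=> cD Dx Dy t0 t1.
have := @cD x y (Itv01 t0 t1); rewrite !inE; exact.
Qed.

Lemma convex_set1 (R : realType) (n : nat) (v : 'rV[R]_n) :
  @convex_set R 'rV[R]_n [set v].
Proof. by move=> x y l; rewrite !inE /= => -> ->; rewrite convmm. Qed.

Lemma ler_norm_Rintegral (R : realType) (n : nat) (D : set 'rV[R]_n) (M B : R)
    (g : 'rV[R]_n -> R) :
  measurable D -> D `<=` cube n M -> continuous g -> (forall y, D y -> `|g y| <= B) ->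
  `|\int[lebesgue_rV R n]_(y in D) g y| <= B * fine (lebesgue_rV R n D).
Proof.
move=> mD DM cg gB.
have ig := integrable_rV mD DM cg.
apply: le_trans (le_normr_Rintegral mD ig) _.
rewrite -Rintegral_cst //; apply: le_Rintegral => //.
  have cg' : continuous (fun y => `|g y|).
    by move=> y; exact: (cvg_norm (cg y)).
  exact: integrable_rV mD DM cg'.
exact: (integrable_rV mD DM (@cst_continuous _ _ B)).
Qed.

Lemma continuous_affine_rV (R : realType) (n : nat) (c b : 'rV[R]_n) : continuous (affine_rV c b).
Proof.
move=> v; apply: (@cvg_matrix _ _ (nbhs v)) => i j.
rewrite [X in _ --> X]mxE; under eq_cvg do rewrite mxE.
apply: (@cvgD _ _ _ (nbhs v)); last exact: cvg_cst.
by apply: (@cvgM _ _ (nbhs v)); [exact: cvg_cst|exact: coord_continuous].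
Qed.

Lemma affine_rV_shift (R : realType) (n : nat) (h v : 'rV[R]_n) : affine_rV (const_mx 1) h v = v + h.
Proof. by apply/rowP => i; rewrite !mxE mul1r. Qed.

Lemma affine_rV_scale (R : realType) (n : nat) (c : R) (v : 'rV[R]_n) : affine_rV (const_mx c) 0 v = c *: v.
Proof. by apply/rowP => i; rewrite !mxE addr0. Qed.

Lemma measurable_preimage_affine_rV (R : realType) (n : nat) (c b : 'rV[R]_n) (D : set 'rV[R]_n) :
  measurable D -> measurable (affine_rV c b @^-1` D).
Proof. by move=> mD; rewrite -[X in measurable X]setTI; exact: measurable_affine_rV. Qed.

(** Bernoulli's inequality: it makes the volume lost by shrinking a body by the factor [1 - d]
    linear in [d]. *)
Lemma ler_1subMn_expr (R : realDomainType) (n : nat) (d : R) :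
  0 <= d -> d <= 1 -> 1 - n%:R * d <= (1 - d) ^+ n.
Proof.
move=> d0 d1; elim: n => [|k IH]; first by rewrite mul0r subr0 expr0.
have : (1 - d) * (1 - k%:R * d) <= (1 - d) ^+ k.+1 by rewrite exprS ler_wpM2l // subr_ge0.
apply: le_trans; rewrite -natr1.
have : 0 <= k%:R * d * d by rewrite !mulr_ge0.
by nra.
Qed.

Section shift.
Context {R : realType} {n : nat}.
Variables (D : set 'rV[R]_n) (M r : R).
Hypotheses (cD : @convex_set R 'rV[R]_n D) (mD : measurable D) (DM : D `<=` cube n M)
  (r0 : 0 < r) (rD : cube n r `<=` D).
Local Notation mu := (lebesgue_rV R n).

(** The set is the homothetic copy [(1 - d) D], written as a preimage. *)
Lemma fine_lebesgue_shrink (d : R) : 0 < d -> d < 1 ->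
  fine (mu [set v | D ((1 - d)^-1 *: v)]) = (1 - d) ^+ n * fine (mu D).
Proof.
move=> d0 d1; have d1' : 0 < 1 - d by rewrite subr_gt0.
pose c : 'rV[R]_n := const_mx ((1 - d)^-1).
have -> : [set v | D ((1 - d)^-1 *: v)] = affine_rV c 0 @^-1` D.
  by apply/seteqP; split => v /=; rewrite affine_rV_scale.
have c0 i : 0 < c 0 i by rewrite mxE invr_gt0.
rewrite -(lebesgue_rV_affine 0 c0 mD) fineM //; last first.
  rewrite ge0_fin_numE //.
  apply: (@lebesgue_rV_bounded _ _ _ ((1 - d) * M)); first exact: measurable_preimage_affine_rV.
  move=> v /= /DM; rewrite affine_rV_scale /cube /= normrZ ger0_norm ?invr_ge0 ?(ltW d1')//.
  by rewrite ler_pdivrMl.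
rewrite /= mulrA; under eq_bigr do rewrite mxE.
rewrite prodr_const card_ord exprVn divff ?mul1r //.
by rewrite expf_neq0 // gt_eqF.
Qed.

(** The point is a convex combination of [d] and of [(r / |h|) h], which lies on the surface of the
    cube contained in [D]. *)
Lemma shift_mem (h d : 'rV[R]_n) : D d -> `|h| < r ->
  D ((1 - `|h| / r) *: d + h).
Proof.
move=> Dd hr.
have [->|h0] := eqVneq h 0.
  by rewrite normr0 mul0r subr0 scale1r addr0.
have nh0 : 0 < `|h| by rewrite normr_gt0.
have {2}-> : h = (1 - (1 - `|h| / r)) *: ((r / `|h|) *: h).
  rewrite opprB addrC subrK scalerA.
  rewrite (_ : _ * _ = 1) ?scale1r//; field.
  by rewrite !gt_eqF.
apply: convex_set_comb => //.
- apply: rD; rewrite /cube /= normrZ ger0_norm ?divr_ge0 ?(ltW r0)//.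
  by rewrite divfK ?gt_eqF.
- by rewrite subr_ge0 ler_pdivrMr // mul1r ltW.
- by rewrite gerBl divr_ge0 // ltW.
Qed.

Lemma Rintegral_shift (g : 'rV[R]_n -> R) (h : 'rV[R]_n) : continuous g ->
  \int[mu]_(y in D) g (y + h) = \int[mu]_(y in [set v | D (v - h)]) g y.
Proof.
move=> cg.
pose o : 'rV[R]_n := const_mx 1.
have mD' : measurable [set v | D (v - h)].
  rewrite (_ : [set _ | _] = affine_rV o (-h) @^-1` D).
    exact: measurable_preimage_affine_rV.
  by apply/seteqP; split => v /=; rewrite affine_rV_shift.
have ED : affine_rV o h @^-1` [set v | D (v - h)] = D.
  by apply/seteqP; split => v /=; rewrite affine_rV_shift addrK.
rewrite [RHS](@Rintegral_rV_affine _ _ o h) //.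
- rewrite ED big1 ?mul1r; last by move=> i _; rewrite mxE.
  by apply: eq_Rintegral => y _; rewrite affine_rV_shift.
- by move=> i; rewrite mxE.
- rewrite ED; apply: (integrable_rV mD DM).
  by move=> y; apply: (@continuous_comp _ _ _ (affine_rV o h) g);
    [exact: continuous_affine_rV|exact: cg].
Qed.

(** With [d = |h| / r], the copy [K = (1 - d) D] lies both in [D] and in [D + h], so the integrals
    cancel over it. Each of the two remainders has measure at most [n d mu(D)], whence the factor
    [n.*2]. *)
Lemma shift_bound (g : 'rV[R]_n -> R) (B : R) (h : 'rV[R]_n) :
  continuous g -> `|h| < r ->
  (forall y, D y -> `|g y| <= B) -> (forall y, D y -> `|g (y + h)| <= B) ->
  `| \int[mu]_(y in D) g (y + h) - \int[mu]_(y in D) g y | <=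
  (n.*2%:R * B / r * fine (mu D)) * `|h|.
Proof.
move=> cg hr gB ghB.
have [->|h0] := eqVneq h 0.
  under eq_Rintegral do rewrite addr0.
  by rewrite subrr !normr0 mulr0.
set d := `|h| / r.
have d0 : 0 < d by rewrite divr_gt0 // normr_gt0.
have d1 : d < 1 by rewrite ltr_pdivrMr // mul1r.
have d1' : 0 < 1 - d by rewrite subr_gt0.
set K := [set v | D ((1 - d)^-1 *: v)].
have D0 : D 0 by apply: rD; rewrite /cube /= normr0 ltW.
have KD : K `<=` D.
  move=> v Kv.
  have := convex_set_comb cD Kv D0 (ltW d1').
  rewrite scaler0 addr0 scalerA divff ?gt_eqF// scale1r; apply.
  by rewrite gerBl ltW.
pose D' := [set v | D (v - h)].
(* [shift_mem] for the opposite vector: [K] is already scaled by [1 - d]. *)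
have KD' : K `<=` D'.
  move=> v Kv; rewrite /D' /=.
  have := @shift_mem (- h) _ Kv; rewrite normrN => /(_ hr).
  by rewrite -/d scalerA divff ?gt_eqF// scale1r.
pose o : 'rV[R]_n := const_mx 1.
have mD' : measurable D'.
  rewrite (_ : D' = affine_rV o (-h) @^-1` D).
    exact: measurable_preimage_affine_rV.
  by apply/seteqP; split => v; rewrite /D' /= affine_rV_shift.
have mK : measurable K.
  rewrite (_ : K = affine_rV (const_mx (1 - d)^-1) 0 @^-1` D).
    exact: measurable_preimage_affine_rV.
  by apply/seteqP; split => v; rewrite /K /= affine_rV_scale.
have DM' : D' `<=` cube n (M + `|h|).
  move=> v /DM; rewrite /cube /= => vM.
  by rewrite -(subrK h v) (le_trans (ler_normD _ _))// lerD2r.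
have muD' : mu D' = mu D.
  rewrite -(@lebesgue_rV_affine R n o (- h) D) //.
    rewrite big1 ?mul1e; last by move=> i _; rewrite mxE.
    congr (mu _).
    by apply/seteqP; split => v; rewrite /D' /= affine_rV_shift.
  by move=> i; rewrite mxE.
rewrite Rintegral_shift //.
have split_int (E : set 'rV[R]_n) N : measurable E -> E `<=` cube n N -> K `<=` E ->
   \int[mu]_(y in E) g y = \int[mu]_(y in K) g y + \int[mu]_(y in E `\` K) g y.
  move=> mE EN KE.
  rewrite -Rintegral_setU //.
  - by rewrite setDUK.
  - exact: measurableD.
  - by rewrite setDUK //; exact: integrable_rV EN cg.
  - by apply/disj_setPS; rewrite setIDA => v [[]].
rewrite (split_int _ _ mD' DM' KD') (split_int _ _ mD DM KD) opprD addrACA subrr add0r.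
have finE (E : set 'rV[R]_n) N : measurable E -> E `<=` cube n N -> mu E \is a fin_num.
  by move=> mE EN; rewrite ge0_fin_numE //; exact: lebesgue_rV_bounded EN.
have muDK (E : set 'rV[R]_n) N : measurable E -> E `<=` cube n N -> K `<=` E ->
    fine (mu (E `\` K)) = fine (mu E) - fine (mu K).
  move=> mE EN KE; rewrite measureD //; last exact: lebesgue_rV_bounded EN.
  rewrite (setIidr KE) fineB //; [exact: finE EN|apply: (finE _ N) => //].
  exact: subset_trans EN.
have B0 : 0 <= B by apply: le_trans (gB _ D0).
have kb (E : set 'rV[R]_n) N : measurable E -> E `<=` cube n N -> K `<=` E ->
    mu E = mu D -> (forall y, E y -> `|g y| <= B) ->
    `|\int[mu]_(y in E `\` K) g y| <= B * (n%:R * d * fine (mu D)).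
  move=> mE EN KE ED gE.
  have EKN : E `\` K `<=` cube n N by apply: subset_trans EN => v [].
  apply: le_trans (@ler_norm_Rintegral _ _ _ N B g _ EKN cg _) _.
  - exact: measurableD.
  - by move=> y [Ey _]; exact: gE.
  rewrite ler_wpM2l // (muDK _ _ mE EN KE) ED fine_lebesgue_shrink //.
  rewrite -[X in X - _]mul1r -mulrBl ler_wpM2r ?fine_ge0 //.
  rewrite lerBlDr -lerBlDl.
  exact: ler_1subMn_expr (ltW d0) (ltW d1).
apply: le_trans (ler_normB _ _) _.
apply: le_trans (lerD (kb _ _ mD' DM' KD' muD' _) (kb _ _ mD DM KD erefl gB)) _.
  by move=> y /ghB; rewrite subrK.
rewrite /d -muln2 natrM le_eqVlt; apply/orP; left; apply/eqP; field.
by rewrite gt_eqF.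
Qed.
End shift.

(** * Gradients of the means over the regions of constancy *)

Section enorm.
Context {R : realType} {n : nat}.
Implicit Types u v : 'rV[R]_n.

Lemma enorm_sum_ge0 v : 0 <= \sum_i v 0 i ^+ 2.
Proof. by apply: sumr_ge0 => i _; exact: sqr_ge0. Qed.

Lemma enorm_ge0 v : 0 <= enorm v.
Proof. exact: sqrtr_ge0. Qed.

Lemma norm_le_enorm v : `|v| <= enorm v.
Proof.
apply: rV_norm_le; first exact: enorm_ge0.
move=> i; rewrite -sqrtr_sqr ler_sqrt ?enorm_sum_ge0//.
rewrite (bigD1 i) //= lerDl; apply: sumr_ge0 => j _; exact: sqr_ge0.
Qed.

(** Bounding each coordinate gives the factor sqrt [n]; the cruder [n] avoids carrying a root. *)
Lemma enorm_le_norm v : enorm v <= n%:R * `|v|.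
Proof.
rewrite -[leRHS]ger0_norm ?mulr_ge0// -sqrtr_sqr ler_sqrt ?sqr_ge0//.
apply: (@le_trans _ _ (\sum_(i < n) `|v| ^+ 2)).
  apply: ler_sum => i _; rewrite -[leLHS]real_normK ?num_real//.
  by rewrite lerXn2r ?nnegrE// rV_coord_le_norm.
rewrite sumr_const card_ord -[leLHS]mulr_natl exprMn ler_wpM2r ?sqr_ge0//.
by rewrite -natrX ler_nat; case: (n) => // k; rewrite expnS expn1 leq_pmulr.
Qed.

Lemma enormZ (c : R) v : enorm (c *: v) = `|c| * enorm v.
Proof.
rewrite /enorm; under eq_bigr do rewrite mxE exprMn.
by rewrite -mulr_sumr sqrtrM ?sqr_ge0// sqrtr_sqr.
Qed.

Lemma enormN v : enorm (- v) = enorm v.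
Proof. by rewrite -scaleN1r enormZ normrN1 mul1r. Qed.

Lemma enorm0 : enorm (0 : 'rV[R]_n) = 0.
Proof. by rewrite -(scale0r 0) enormZ normr0 mul0r. Qed.

Lemma enorm_gt0 v : (0 < enorm v) = (v != 0).
Proof.
have [->|v0] := eqVneq v 0; first by rewrite enorm0 ltxx.
by apply: lt_le_trans (norm_le_enorm v); rewrite normr_gt0.
Qed.

Lemma continuous_enorm : continuous (@enorm R n).
Proof.
move=> v; apply: (@continuous_comp _ _ _ (fun v : 'rV[R]_n => \sum_i v 0 i ^+ 2) (@Num.sqrt R)).
  apply: continuous_big => [|i _ w]; first by move=> z; apply: (@cvgD _ _ _ (nbhs z));
    [exact: cvg_fst|exact: cvg_snd].
  by apply: (@cvgM _ _ (nbhs w)); exact: coord_continuous.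
exact: sqrt_continuous.
Qed.

End enorm.

Lemma lipschitz_rV_norm (R : realType) (n : nat) (f : 'rV[R]_n -> R) : lipschitz_rV f ->
  exists2 L : R, 0 <= L & forall x y, `|f x - f y| <= L * `|x - y|.
Proof.
move=> [L fL]; exists (`|L| * n%:R); first by rewrite mulr_ge0.
move=> x y; apply: le_trans (fL x y) _; rewrite -mulrA.
apply: (@le_trans _ _ (`|L| * enorm (x - y))).
  by rewrite ler_wpM2r ?enorm_ge0 ?ler_norm.
by rewrite ler_wpM2l ?enorm_le_norm.
Qed.

Lemma lipschitz_norm_continuous (R : realType) (n : nat) (f : 'rV[R]_n -> R) (L : R) :
  0 <= L -> (forall x y, `|f x - f y| <= L * `|x - y|) -> continuous f.
Proof.
move=> L0 fL v; apply/(@cvgrPdist_le _ _ _ (nbhs v)) => e e0.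
have eL : 0 < e / (L + 1) by rewrite divr_gt0 // ltr_wpDl.
have F0 : Filter (nbhs v) by exact: nbhs_filter.
have := @cvgr_dist_le _ _ _ (nbhs v) F0 id v cvg_id _ eL.
apply: (@filterS _ (nbhs v) F0) => w.
rewrite ler_pdivlMr ?ltr_wpDl // => vw; apply: le_trans (fL _ _) _; apply: le_trans vw.
by rewrite mulrC ler_wpM2l // lerDl.
Qed.

Section region.
Context {R : realType} {n : nat}.
Implicit Types (x : 'rV[R]_n) (eps : R^nat).

Lemma continuous_enorm_dist (x0 : 'rV[R]_n) : continuous (fun z : 'rV[R]_n => enorm (z - x0)).
Proof.
move=> z; apply: (@continuous_comp _ _ _ (fun z : 'rV[R]_n => z - x0) (@enorm R n)).
  by apply: (@cvgB _ _ _ (nbhs z)); [exact: cvg_id|exact: cvg_cst].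
exact: continuous_enorm.
Qed.

Lemma near_region (x0 : 'rV[R]_n) eps i x : region x0 eps i x -> \forall z \near x, region x0 eps i z.
Proof.
move=> /andP[e1 e2].
have cx := @continuous_enorm_dist x0 x.
near=> z; apply/andP; split; near: z.
- exact: (@cvgr_gt _ _ (nbhs x) _ _ _ cx).
- exact: (@cvgr_lt _ _ (nbhs x) _ _ _ cx).
Unshelve. all: by end_near. Qed.

End region.

Lemma littleo_dist (R : realType) (n : nat) (f : 'rV[R]_n -> R) (x0 : 'rV[R]_n) (e : R) :
  differentiable f x0 -> 0 < e -> exists2 d : R, 0 < d &
    forall z, `|z - x0| < d -> `|f z - f x0 - 'd f x0 (z - x0)| <= e * `|z - x0|.
Proof.
move=> df e0.
have := diff_locally df.
move/eqaddoP => /(_ _ e0) /nbhs_normP[d /= d0 H].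
exists d => // z zd.
have := H (z - x0); rewrite /= sub0r normrN => /(_ zd).
rewrite -[(_ - _) (z - x0)]/(f (z - x0 + x0) - (f x0 + 'd f x0 (z - x0))).
by rewrite subrK opprD addrA.
Qed.

Section gradient_estimate.
Context {R : realType} {n : nat}.
Variables (S : set 'rV[R]_n.+1) (x0 : 'rV[R]_n.+1) (D : 'rV[R]_n.+1 -> set 'rV[R]_n.+1) (eps : R^nat).
Hypothesis XiD : Xi S x0 D eps.

(** The point [x0 - u] is at the same distance from [x0] as [x], hence in the same region with the
    same body; the interior condition there says that [x0] belongs to [x0 - u + D x]. *)
Lemma Xi_sphere i x : region x0 eps i x ->
  (forall u, enorm u = enorm (x - x0) -> S (x0 + u)) ->
  forall u, enorm u = enorm (x - x0) -> D x u.
Proof.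
move=> rx Sx u ux.
have xu : region x0 eps i (x0 - u).
  by rewrite /region /= addrAC subrr add0r enormN ux.
have u0 : 0 < enorm u.
  by rewrite ux; case/andP: rx => + _; apply: lt_trans; exact: Xi_eps_gt0 XiD _.
have := Xi_interior XiD (Sx (- u) _) _; rewrite enormN => /(_ ux).
rewrite -subr_eq0 addrAC subrr add0r oppr_eq0 -enorm_gt0 => /(_ u0) /interior_subset [y].
rewrite (Xi_constant XiD xu rx) => Dy.
by rewrite -addrA => /eqP; rewrite addrC -subr_eq0 addrK addrC subr_eq0 => /eqP <-.
Qed.

(** The cube is inside the Euclidean ball of radius [enorm (x - x0)], and every point of that ball
    lies between two antipodal points of its sphere, which [Xi_sphere] puts in [D x]. *)
Lemma Xi_cube i x : region x0 eps i x ->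
  (forall u, enorm u = enorm (x - x0) -> S (x0 + u)) ->
  cube n.+1 (enorm (x - x0) / n.+1%:R) `<=` D x.
Proof.
move=> rx Sx z; rewrite /cube /= ler_pdivlMr // mulrC => zs.
have {zs} := le_trans (enorm_le_norm z) zs.
set s := enorm (x - x0) => zs.
have s0 : 0 < s by case/andP: rx => + _; apply: lt_trans; exact: Xi_eps_gt0 XiD _.
have DS := Xi_sphere rx Sx.
(* [p] is the direction of [z]; at [z = 0] any point of the sphere does, such as [x - x0]. *)
have [p ps zp] : exists2 p, enorm p = s & z = (enorm z / s) *: p.
  have [->|z0] := eqVneq z 0; first by exists (x - x0); rewrite // enorm0 mul0r scale0r.
  have ez : 0 < enorm z by rewrite enorm_gt0.
  exists ((s / enorm z) *: z).
    by rewrite enormZ ger0_norm ?divr_ge0 ?ltW// divfK ?gt_eqF.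
  by rewrite scalerA (_ : _ * _ = 1) ?scale1r//; field; rewrite !gt_eqF.
have Dp := DS p ps; have DNp : D x (- p) by apply: DS; rewrite enormN.
have t0 : 0 <= enorm z / s by rewrite divr_ge0 ?enorm_ge0 ?ltW.
have t1 : enorm z / s <= 1 by rewrite ler_pdivrMr ?mul1r.
rewrite zp; move: (enorm z / s) t0 t1 => t t0 t1.
have -> : t *: p = ((1 + t) / 2) *: p + (1 - (1 + t) / 2) *: (- p).
  by rewrite scalerN -scalerBl; congr (_ *: _); field.
by apply: (convex_set_comb (Xi_convex XiD (x := x)) Dp DNp); lra.
Qed.

(** Once [0] is in [D x], its points are within one diameter of [0]. Compactness bounds the set of
    distances, so that the supremum [diameter (D x)] is really an upper bound. *)
Lemma Xi_enorm_le : exists2 k : R, 0 < k &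
  forall x y, D x 0 -> D x y -> enorm y <= k * enorm (x - x0).
Proof.
have [k Dk] := Xi_diameter_le XiD.
exists (`|k| + 1); first by rewrite ltr_wpDl.
move=> x y D0 Dy.
apply: (@le_trans _ _ (diameter (D x))); last first.
  apply: le_trans (Dk x) _; rewrite ler_wpM2r ?enorm_ge0//.
  by apply: le_trans (ler_norm _) _; rewrite lerDl.
have /compact_bounded[N [_ NM]] := Xi_compact XiD (x := x).
apply: ub_le_sup; last by exists (y, 0) => //=; rewrite subr0.
exists (n.+1%:R * ((`|N| + 1) + (`|N| + 1))) => _ [[a b] /= [Da Db] <-].
apply: le_trans (enorm_le_norm _) _; rewrite ler_wpM2l //.
have N1 : N < `|N| + 1 by rewrite (le_lt_trans (ler_norm _)) // ltrDl.
apply: le_trans (ler_normB _ _) _; apply: lerD; exact: (NM _ N1).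
Qed.

Lemma lebesgue_cube_gt0 (r : R) (A : set 'rV[R]_n.+1) M : 0 < r -> measurable A ->
  A `<=` cube n.+1 M -> cube n.+1 r `<=` A -> 0 < fine (lebesgue_rV R n.+1 A).
Proof.
move=> r0 mA AM rA.
rewrite fine_gt0 // (lebesgue_rV_bounded mA AM) andbT.
apply: (@lt_le_trans _ _ (lebesgue_rV R n.+1 (cube n.+1 r))).
  by rewrite lebesgue_cube ?ltW// lte_fin exprn_gt0 // mulrn_wgt0.
by apply: le_measure; rewrite ?inE //; apply: closed_measurable_rV; exact: closed_cube.
Qed.

Variable f : 'rV[R]_n.+1 -> R.
Hypotheses (Sx0 : nbhs x0 S) (cf : continuous f) (df : differentiable f x0).
Local Notation mu := (lebesgue_rV R n.+1).
Local Notation phi := (mean_value f D).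

(** The radius [d] serves all regions at once: the remainder and the half-side [r] of the inner cube
    are both proportional to [s], so [s] cancels. *)
Lemma gradient_mean_value (e : R) : 0 < e -> exists2 d : R, 0 < d &
  forall i x, region x0 eps i x -> `|x - x0| < d -> differentiable phi x ->
  `|gradient phi x - gradient f x0| <= e.
Proof.
move=> e0.
have [k k0 Dk] := Xi_enorm_le.
pose N : R := n.+1%:R.
have N0 : 0 < N by rewrite ltr0n.
(* [2 N] comes from [shift_bound], the other [N] from [r = s / N], and [k + 2] from the distance to
   [x0] of a point of the shifted body. *)
pose C := 2 * N * N * (k + 2).
have C0 : 0 < C by rewrite !mulr_gt0 // addr_gt0.
have [d1 d10 fd] := littleo_dist df (divr_gt0 e0 C0).
have /nbhs_normP[d2 /= d20 Sd] := Sx0.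
(* [d2] keeps the sphere through [x] inside [S]; [d1 / (k + 2)] keeps the shifted body where the
   expansion of [f] is valid. *)
pose m := Num.min d2 (d1 / (k + 2)).
have m0 : 0 < m by rewrite lt_min d20 divr_gt0 // addr_gt0.
exists (m / N); first by rewrite divr_gt0.
move=> i x rx; rewrite ltr_pdivlMr // mulrC => xm dphi.
set s := enorm (x - x0).
have sm : s < m by exact: le_lt_trans (enorm_le_norm _) xm.
have s0 : 0 < s by case/andP: rx => + _; apply: lt_trans; exact: Xi_eps_gt0 XiD _.
have Su u : enorm u = s -> S (x0 + u).
  move=> us; apply: Sd; rewrite /= opprD addrA subrr add0r normrN.
  apply: le_lt_trans (norm_le_enorm _) _; rewrite us; apply: lt_le_trans sm _.
  by rewrite /m ge_min lexx.
have rD := Xi_cube rx Su; rewrite -/s -/N in rD.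
set r := s / N in rD.
have r0 : 0 < r by rewrite divr_gt0.
have D0 : D x 0 by apply: rD; rewrite /cube /= normr0 ltW.
have DM : D x `<=` cube n.+1 (k * s).
  by move=> y Dy; apply: le_trans (norm_le_enorm _) _; exact: Dk.
have mD : measurable (D x).
  apply: closed_measurable_rV.
  exact: (compact_closed (@norm_hausdorff _ 'rV[R]_n.+1) (Xi_compact XiD (x := x))).
have V0 : 0 < fine (mu (D x)) by exact: (lebesgue_cube_gt0 r0 mD DM rD).
pose g z := f z - f x0 - 'd f x0 (z - x0).
have cdf : continuous ('d f x0) by exact: diff_continuous.
have cg : continuous g.
  move=> z; apply: (@cvgB _ _ _ (nbhs z)); first by apply: (@cvgB _ _ _ (nbhs z));
    [exact: cf|exact: cvg_cst].
  apply: (@continuous_comp _ _ _ (fun z : 'rV[R]_n.+1 => z - x0) ('d f x0)); last exact: cdf.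
  by apply: (@cvgB _ _ _ (nbhs z)); [exact: cvg_id|exact: cvg_cst].
have cgx : continuous (fun y : 'rV[R]_n.+1 => g (x + y)).
  move=> z; apply: (@continuous_comp _ _ _ (fun z : 'rV[R]_n.+1 => x + z) g); last exact: cg.
  by apply: (@cvgD _ _ _ (nbhs z)); [exact: cvg_cst|exact: cvg_id].
pose B := e / C * ((k + 2) * s).
(* The distance to [x0] is at most [s] for [x], [k s] for [y] and less than [r <= s] for [h]. *)
have gB y h : D x y -> `|h| < r -> `|g (x + y + h)| <= B.
  move=> /DM; rewrite /cube /= => yM hr.
  have xyh : `|x + y + h - x0| < (k + 2) * s.
    have -> : x + y + h - x0 = (x - x0) + y + h by rewrite addrC !addrA; congr (_ + _ + _); rewrite addrC.
    apply: le_lt_trans (ler_normD _ _) _.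
    have : `|x - x0 + y| <= s + k * s.
      by apply: le_trans (ler_normD _ _) _; rewrite lerD // norm_le_enorm.
    have : r <= s by rewrite ler_pdivrMr // -{1}[s]mulr1 ler_wpM2l ?(ltW s0)// ler1n.
    by move=> rs xy; lra.
  apply: le_trans (fd _ _) _.
    apply: lt_trans xyh _; rewrite mulrC -ltr_pdivlMr ?addr_gt0//.
    by apply: lt_le_trans sm _; rewrite /m ge_min lexx orbT.
  by rewrite ler_wpM2l ?divr_ge0 ?ltW.
pose a j : 'rV[R]_n.+1 := delta_mx 0 j.
have na j : `|a j| <= 1 by exact: norm_delta_rV.
apply: rV_norm_le; first exact: ltW.
move=> j; rewrite !mxE -/(a j) (deriveE _ df).
have := diff_derivable dphi (v := a j).
rewrite /derivable => /cvg_ex[l hl].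
have -> : 'D_(a j) phi x = l by apply: cvg_lim hl.
(* The bound is closed in the limit [l], so it is enough to prove it for difference quotients with
   small [t]. *)
have cl : closed [set z : R | `|z - 'd f x0 (a j)| <= e].
  apply: (@preimage_closed _ _ (fun z : R => `|z - 'd f x0 (a j)|) [set z | z <= e]).
    move=> z _; apply: (@cvg_norm _ _ _ (nbhs z)).
    by apply: (@cvgB _ _ _ (nbhs z)); [exact: cvg_id|exact: cvg_cst].
  exact: closed_le.
apply: (@closed_cvg _ _ _ _ _ (fun z => `|z - 'd f x0 (a j)| <= e) cl _ l hl).
(* Regions are open: for small [t] the body does not change, and only the integrand is
   translated. *)
have nearD : \forall t \near (0 : R)^', region x0 eps i (t *: a j + x).
  have ct : t *: a j + x @[t --> (0 : R)] --> x.
    rewrite -[X in _ --> X]add0r -(scale0r (a j)).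
    by apply: (@cvgD _ _ _ (nbhs (0:R))); [apply: cvgZr_tmp; exact: cvg_id|exact: cvg_cst].
  by apply: cvg_within; exact: (ct _ (near_region rx)).
near=> t.
have t0 : t != 0 by near: t; exact: nbhs_dnbhs_neq.
have tr : `|t| < r by near: t; apply: dnbhs0_lt.
have Dt : D (t *: a j + x) = D x.
  by apply: (Xi_constant XiD _ rx); near: t.
have tar : `|t *: a j| < r.
  rewrite normrZ; apply: le_lt_trans tr.
  by rewrite -[leRHS]mulr1 ler_wpM2l.
pose I := \int[mu]_(y in D x) g (x + (y + t *: a j)) - \int[mu]_(y in D x) g (x + y).
have sb : `|I| <=
    ((n.+1).*2%:R * B / r * fine (mu (D x))) * `|t *: a j|.
  apply: (@shift_bound _ _ (D x) _ r (Xi_convex XiD (x := x)) mD DM r0 rD _ B (t *: a j) cgx tar).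
    by move=> y Dy; rewrite -[x + y]addr0 gB // normr0.
  by move=> y Dy; rewrite addrA gB.
rewrite /= /mean_value Dt -mulrBr.
have cshift (F : 'rV[R]_n.+1 -> R) u : continuous F -> continuous (fun y : 'rV[R]_n.+1 => F (u + y)).
  move=> cF z; apply: (@continuous_comp _ _ _ (fun z : 'rV[R]_n.+1 => u + z) F); last exact: cF.
  by apply: (@cvgD _ _ _ (nbhs z)); [exact: cvg_cst|exact: cvg_id].
have ifx u : mu.-integrable (D x) (EFin \o (fun y => f (u + y))).
  by apply: (integrable_rV mD DM); exact: cshift.
have igx u : mu.-integrable (D x) (EFin \o (fun y => g (u + y))).
  by apply: (integrable_rV mD DM); exact: cshift.
have Exy y : x + (y + t *: a j) = t *: a j + x + y by rewrite addrA addrC addrA.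
(* The affine part of [f] contributes exactly [t] times the partial derivative times the volume; [I]
   is the contribution of the remainder. *)
have -> : \int[mu]_(y in D x) f (t *: a j + x + y) - \int[mu]_(y in D x) f (x + y) =
   t * 'd f x0 (a j) * fine (mu (D x)) + I.
  rewrite /I.
  under [X in _ = _ + (X - _)]eq_Rintegral do rewrite Exy.
  rewrite -RintegralB //= -RintegralB //= -Rintegral_cst // -RintegralD //=; last 2 first.
  - exact: (integrable_rV mD DM (@cst_continuous _ _ _)).
  - rewrite [X in integrable _ _ X](_ : _ = EFin \o (fun y => g (t *: a j + x + y) - g (x + y))) //.
    apply: (integrable_rV mD DM) => z.
    by apply: (@cvgB _ _ _ (nbhs z)); exact: (cshift g).
  apply: eq_Rintegral => y _; rewrite /g.
  have -> : 'd f x0 (t *: a j + x + y - x0) = t * 'd f x0 (a j) + 'd f x0 (x + y - x0).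
    by rewrite -!addrA linearD linearZ.
  ring.
rewrite [X in `|X|](_ : _ = t^-1 * (fine (mu (D x)))^-1 * I); last first.
  rewrite -[_ *: _]/(_ * _); field.
  by rewrite t0 gt_eqF.
rewrite !normrM !normfV (ger0_norm (ltW V0)).
apply: (@le_trans _ _ (`|t|^-1 * (fine (mu (D x)))^-1 *
   (((n.+1).*2%:R * B / r * fine (mu (D x))) * `|t|))).
  rewrite ler_wpM2l ?mulr_ge0 ?invr_ge0 ?(ltW V0)//.
  apply: le_trans sb _; rewrite ler_wpM2l //.
    rewrite mulr_ge0 ?(ltW V0)// divr_ge0 ?(ltW r0)// mulr_ge0 //.
    rewrite /B mulr_ge0 ?divr_ge0 ?(ltW e0) ?(ltW C0)// mulr_ge0 ?(ltW s0)//.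
    by rewrite addr_ge0 // ltW.
  by rewrite normrZ -[leRHS]mulr1 ler_wpM2l.
(* All factors cancel and exactly [e] is left. *)
rewrite /B /r /C -muln2 natrM -/N le_eqVlt; apply/orP; left; apply/eqP; field.
by rewrite !gt_eqF // ?normr_gt0 ?addr_gt0.
Unshelve. all: by end_near. Qed.
End gradient_estimate.

(** * Differentiability of averages over cubes *)

(** The increment is o(h), so the zero map is the differential. *)
Lemma differentiable_quadratic (R : realType) (n : nat) (F : 'rV[R]_n -> R) (x : 'rV[R]_n) (K : R) :
  (\forall h \near (0 : 'rV[R]_n), `|F (h + x) - F x| <= K * `|h| ^+ 2) ->
  differentiable F x.
Proof.
move=> HF.
have E : F \o shift x = cst (F x) + (\0 : 'rV[R]_n -> R) +o_ (0 : 'rV[R]_n) id.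
  apply/eqaddoP => e e0.
  have eK : 0 < e / (`|K| + 1) by rewrite divr_gt0 // ltr_wpDl.
  near=> h.
  rewrite -[(_ - _) h]/(F (h + x) - (F x + 0)) addr0.
  have /le_trans : `|F (h + x) - F x| <= K * `|h| ^+ 2 by near: h.
  apply; rewrite expr2 mulrA ler_wpM2r //.
  have : `|h| < e / (`|K| + 1).
    near: h; have := @cvgr0_norm_lt _ _ _ (nbhs (0 : 'rV[R]_n)) _ id cvg_id _ eK; exact.
  rewrite ltr_pdivlMr ?ltr_wpDl // => he.
  have := ler_norm K; have : 0 <= `|h| by []. nra.
have c0 : continuous (\0 : 'rV[R]_n -> R) by exact: cst_continuous.
have d0 := diff_unique c0 E.
by apply/diff_locallyP; rewrite d0.
Unshelve. all: by end_near. Qed.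

(** [F - G] vanishes near [x], which is the quadratic bound with constant [0]. *)
Lemma near_eq_differentiable (R : realType) (n : nat) (F G : 'rV[R]_n -> R) (x : 'rV[R]_n) :
  differentiable G x -> (\forall z \near x, F z = G z) -> differentiable F x.
Proof.
move=> dG FG.
have -> : F = G + (F - G) by apply/funext => z; rewrite addrC subrK.
apply: differentiableD => //.
apply: (@differentiable_quadratic _ _ _ _ 0).
have FGx := nbhs_singleton FG.
have : \forall h \near (0 : 'rV[R]_n), F (h + x) = G (h + x).
  have cx : (h + x) @[h --> (0 : 'rV[R]_n)] --> x.
    rewrite -[X in _ --> X]add0r.
    by apply: (@cvgD _ _ _ (nbhs (0 : 'rV[R]_n))); [exact: cvg_id|exact: cvg_cst].
  exact: (cx _ FG).
apply: filterS => h E.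
rewrite -[(F - G) _]/(F (h + x) - G (h + x)) -[(F - G) x]/(F x - G x).
by rewrite E FGx !subrr normr0 mul0r.
Qed.

(** The increment is followed along a path parallel to the axes: each edge costs a quadratic error,
    plus the change of [G j] between [x] and the start of the edge, which the Lipschitz bound also
    makes quadratic. *)
Lemma differentiable_lipschitz_partials (R : realType) (n : nat) (F : 'rV[R]_n -> R)
    (G : 'I_n -> 'rV[R]_n -> R) (C L a : R) : 0 < a -> 0 <= C -> 0 <= L ->
  (forall j x t, `|t| <= a ->
     `|F (x + t *: delta_mx 0 j) - F x - t * G j x| <= C * t ^+ 2) ->
  (forall j x y, `|G j x - G j y| <= L * `|x - y|) ->
  forall x, differentiable F x.
Proof.
move=> a0 C0 L0 FG LG x.
(* Induction on the coordinates already moved; the first half bounds the displacement of the base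
   point that the second half needs. *)
have key (h : 'rV[R]_n) (s : seq 'I_n) : `|h| <= a ->
   `|\sum_(j <- s) h 0 j *: delta_mx 0 j : 'rV[R]_n| <= (size s)%:R * `|h| /\
   `|F (x + \sum_(j <- s) h 0 j *: delta_mx 0 j) - F x - \sum_(j <- s) h 0 j * G j x|
     <= (size s)%:R * (C + L * (size s)%:R) * `|h| ^+ 2.
  move=> ha; elim: s => [|j s [IH1 IH2]].
    by rewrite !big_nil addr0 subrr subr0 !normr0 mul0r mul0r.
  rewrite !big_cons.
  have hj : `|h 0 j| <= `|h| by exact: rV_coord_le_norm.
  split.
    apply: le_trans (ler_normD _ _) _; rewrite /= -natr1 mulrDl mul1r addrC lerD //.
    rewrite normrZ; apply: le_trans hj.
    by rewrite -[leRHS]mulr1 ler_wpM2l // norm_delta_rV.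
  set S := (\sum_(j <- s) _) in IH1 IH2 *; set T := (\sum_(j <- s) h 0 j * _) in IH2 *.
  have := FG j (x + S) (h 0 j) (le_trans hj ha).
  have := LG j (x + S) x; rewrite [x + S - x]addrC addKr => e1 e2.
  have -> : x + (h 0 j *: delta_mx 0 j + S) = x + S + h 0 j *: delta_mx 0 j.
    by rewrite -addrA [S + _]addrC.
  have -> : F (x + S + h 0 j *: delta_mx 0 j) - F x - (h 0 j * G j x + T) =
     (F (x + S + h 0 j *: delta_mx 0 j) - F (x + S) - h 0 j * G j (x + S)) +
     (h 0 j * (G j (x + S) - G j x)) + (F (x + S) - F x - T) by ring.
  have e3 : `|h 0 j * (G j (x + S) - G j x)| <= L * (size s)%:R * `|h| ^+ 2.
    rewrite normrM; apply: (@le_trans _ _ (`|h| * (L * ((size s)%:R * `|h|)))).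
      apply: ler_pM => //; apply: le_trans e1 _; exact: ler_wpM2l.
    by rewrite le_eqVlt; apply/orP; left; apply/eqP; ring.
  have e4 : C * h 0 j ^+ 2 <= C * `|h| ^+ 2.
    by rewrite ler_wpM2l // -[leLHS]real_normK ?num_real // lerXn2r ?nnegrE.
  apply: le_trans (ler_normD _ _) _.
  apply: le_trans (lerD (ler_normD _ _) IH2) _.
  apply: le_trans (lerD (lerD (le_trans e2 e4) e3) (lexx _)) _.
  rewrite /= -natr1.
  have : 0 <= (size s)%:R :> R by [].
  have : 0 <= `|h| ^+ 2 by rewrite sqr_ge0.
  move: (`|h| ^+ 2) ((size s)%:R) => u v u0 v0.
  rewrite -!mulrDl ler_wpM2r //.
  have : 0 <= L * v by rewrite mulr_ge0.
  by nra.
(* Subtracting the expected differential leaves a function with quadratic increments. *)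
pose lin : 'rV[R]_n -> R := \sum_j (fun z : 'rV[R]_n => G j x * z 0 j).
have dlin : differentiable lin x.
  apply: differentiable_sum => j.
  apply: (@differentiableZ _ _ _ (fun z : 'rV[R]_n => z 0 j : R^o)).
  exact: differentiable_coord.
have -> : F = lin + (F - lin) by apply/funext => z; rewrite addrC subrK.
apply: differentiableD => //.
apply: (@differentiable_quadratic _ _ _ _ (n%:R * (C + L * n%:R))).
near=> h.
have ha : `|h| <= a.
  near: h; have := @cvgr0_norm_le _ _ _ (nbhs (0 : 'rV[R]_n)) _ id cvg_id _ a0; exact.
have [_] := key h (index_enum 'I_n) ha.
have -> : size (index_enum 'I_n) = n by rewrite /index_enum -enumT size_enum_ord.
have linE z : lin z = \sum_j G j x * z 0 j by rewrite /lin fct_sumE.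
rewrite -[(F - lin) _]/(F (h + x) - lin (h + x)) -[(F - lin) x]/(F x - lin x).
have -> : \sum_(j <- index_enum 'I_n) h 0 j *: delta_mx 0 j = h.
  by rewrite [RHS]row_sum_delta.
have -> : \sum_(j <- index_enum 'I_n) h 0 j * G j x = lin (h + x) - lin x.
  rewrite !linE -sumrB; apply: eq_bigr => j _; rewrite mxE; ring.
by rewrite [x + h]addrC; congr (`|_| <= _); ring.
Unshelve. all: by end_near. Qed.



(** * Slabs along opposite faces of a cube *)

Section slab.
Context {R : realType} {n : nat}.
Variables (f : 'rV[R]_n -> R) (L a : R) (l : 'I_n).
Hypotheses (L0 : 0 <= L) (fL : forall x y, `|f x - f y| <= L * `|x - y|) (a0 : 0 < a).
Local Notation mu := (lebesgue_rV R n).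

Definition slab (I : set (measurableTypeR R)) : set 'rV[R]_n :=
  [set v | forall j, (if j == l then I else `[- a, a]%classic) (v 0 j)].

(** At [t = 0] the coordinate [l] collapses to [b]: a face is the limit of thin slabs parametrized
    by a fixed one. *)
Definition stretch (t b : R) : 'rV[R]_n -> 'rV[R]_n :=
  affine_rV (\row_j (if j == l then t else 1)) (b *: delta_mx 0 l).

Lemma stretchE t b v j : stretch t b v 0 j = if j == l then t * v 0 l + b else v 0 j.
Proof. by rewrite !mxE eqxx /=; case: eqP => [->|_]; rewrite ?mulr1// mul1r mulr0 addr0. Qed.

Lemma measurable_slab I : measurable I -> measurable (slab I).
Proof. by move=> mI; apply: (@measurable_box _ _
  (fun j => if j == l then I else `[- a, a]%classic)) => j; case: ifP. Qed.

Lemma slab_cube I M : I `<=` `[- M, M]%classic -> slab I `<=` cube n (a + `|M|).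
Proof.
move=> IM v vI; apply: rV_norm_le; first by rewrite addr_ge0 // ltW.
move=> j; have := vI j; case: eqP => [->|_].
  move=> /IM /=; rewrite in_itv /= -ler_norml => /le_trans; apply.
  by apply: le_trans (ler_norm _) _; rewrite lerDr ltW.
by rewrite /= in_itv /= -ler_norml => /le_trans; apply; rewrite lerDl.
Qed.

Lemma slab_full : slab `[- a, a]%classic = cube n a.
Proof.
apply/seteqP; split => v.
  move=> vI; apply: rV_norm_le => [|j]; first exact: ltW.
  by have := vI j; case: ifP => _; rewrite /= in_itv /= -ler_norml.
move=> va j.
suff : `[- a, a]%classic (v 0 j) by case: ifP.
by rewrite /= in_itv /= -ler_norml; apply: le_trans va; exact: rV_coord_le_norm.
Qed.

Lemma slab_shift (I : set (measurableTypeR R)) t :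
  [set v | slab I (v - t *: delta_mx 0 l)] = slab [set s | I (s - t)].
Proof.
apply/seteqP; split => v vI j; have := vI j; rewrite !mxE eqxx /=.
  by case: eqP => [->|_] /=; rewrite ?mulr1// mulr0 subr0.
by case: eqP => [->|_] /=; rewrite ?mulr1// mulr0 subr0.
Qed.

Lemma slab_preimage t b (I : set (measurableTypeR R)) :
  stretch t b @^-1` slab I = slab [set s | I (t * s + b)].
Proof.
apply/seteqP; split => v vI j; have := vI j; rewrite stretchE /=; by case: eqP => [->|_].
Qed.

Let cf : continuous f.
Proof. exact: lipschitz_norm_continuous L0 fL. Qed.

Lemma continuous_shift x : continuous (fun y : 'rV[R]_n => f (x + y)).
Proof.
move=> z; apply: (@continuous_comp _ _ _ (fun z : 'rV[R]_n => x + z) f); last exact: cf.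
by apply: (@cvgD _ _ _ (nbhs z)); [exact: cvg_cst|exact: cvg_id].
Qed.

Lemma continuous_stretch x t b : continuous (fun y : 'rV[R]_n => f (x + stretch t b y)).
Proof.
move=> z; apply: (@continuous_comp _ _ _ (stretch t b) (fun y : 'rV[R]_n => f (x + y))).
  exact: continuous_affine_rV.
exact: continuous_shift.
Qed.

Lemma Rintegral_slabU (I J : set (measurableTypeR R)) M x : measurable I -> measurable J ->
  I `<=` `[- M, M]%classic -> J `<=` `[- M, M]%classic -> [disjoint I & J] ->
  \int[mu]_(y in slab (I `|` J)) f (x + y) =
  \int[mu]_(y in slab I) f (x + y) + \int[mu]_(y in slab J) f (x + y).
Proof.
move=> mI mJ IM JM IJ.
have E : slab (I `|` J) = slab I `|` slab J.
  apply/seteqP; split => v; last by move=> [] vI j; have := vI j; case: ifP => // _ ?; [left|right].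
  move=> vIJ; have := vIJ l; rewrite eqxx => -[] vl; [left|right] => j;
    by have := vIJ j; case: eqP => [->|].
rewrite E Rintegral_setU //; try exact: measurable_slab.
  apply: (@integrable_rV _ _ _ (a + `|M|)); last exact: continuous_shift.
    by apply: measurableU; exact: measurable_slab.
  by rewrite subUset; split; exact: slab_cube.
apply/disj_setPS => v [vI vJ]; move/disj_setPS: IJ => IJ; apply: (IJ (v 0 l)).
by split; [have := vI l|have := vJ l]; rewrite eqxx.
Qed.

(** With [J] of unit length, the thickness of the slab comes out as the factor [t] and the domain no
    longer depends on [t]. *)
Lemma Rintegral_slab_stretch (I J : set (measurableTypeR R)) M t b x : 0 < t ->
  measurable I -> measurable J -> J `<=` `[- M, M]%classic ->
  (forall s, J s <-> I (t * s + b)) ->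
  \int[mu]_(y in slab I) f (x + y) = t * \int[mu]_(y in slab J) f (x + stretch t b y).
Proof.
move=> t0 mI mJ JM IJ.
have E : stretch t b @^-1` slab I = slab J.
  by rewrite slab_preimage; congr slab; apply/seteqP; split => s /=; apply IJ.
rewrite (@Rintegral_rV_affine _ _ (\row_j (if j == l then t else 1)) (b *: delta_mx 0 l)) //.
- rewrite -/(stretch t b) E; congr (_ * _).
  rewrite (bigD1 l) //= mxE eqxx big1 ?mulr1// => j /negPf jl.
  by rewrite mxE jl.
- by move=> j; rewrite mxE; case: ifP.
- exact: measurable_slab.
- exact: continuous_shift.
- rewrite -/(stretch t b) E.
  apply: (@integrable_rV _ _ _ (a + `|M|)); last exact: continuous_stretch.
    exact: measurable_slab.
  exact: slab_cube.
Qed.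

(** The integrand ignores the coordinate [l] of [y], so this is the integral over the face at height
    [b] times the length of [J]; the extra direction avoids a measure of lower dimension. *)
Definition face (J : set (measurableTypeR R)) b x := \int[mu]_(y in slab J) f (x + stretch 0 b y).

Lemma ler_dist_Rintegral_slab (J : set (measurableTypeR R)) (g h : 'rV[R]_n -> R) (B : R) :
  measurable J -> J `<=` `[- 1, 1]%classic -> continuous g -> continuous h ->
  0 <= B -> (forall y, slab J y -> `|g y - h y| <= B) ->
  `|\int[mu]_(y in slab J) g y - \int[mu]_(y in slab J) h y| <= B * fine (mu (cube n (a + 1))).
Proof.
move=> mJ J1 cg ch B0 gh.
have mS := measurable_slab mJ.
have := slab_cube J1; rewrite normr1 => SC.
rewrite -RintegralB //; [|exact: integrable_rV SC cg|exact: integrable_rV SC ch].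
apply: (le_trans (@ler_norm_Rintegral _ _ _ _ B _ mS SC _ gh)).
  by move=> z; apply: (@cvgB _ _ _ (nbhs z)); [exact: cg|exact: ch].
have mC : measurable (cube n (a + 1)) by apply: closed_measurable_rV; exact: closed_cube.
rewrite ler_wpM2l // fine_le ?ge0_fin_numE ?(lebesgue_rV_bounded mS SC)
  ?(lebesgue_rV_bounded mC (@subset_refl _ _))//.
by apply: le_measure; rewrite ?inE.
Qed.

Lemma face_lipschitz (J : set (measurableTypeR R)) (b : R) (x x' : 'rV[R]_n) :
  measurable J -> J `<=` `[- 1, 1]%classic ->
  `|face J b x - face J b x'| <= L * fine (mu (cube n (a + 1))) * `|x - x'|.
Proof.
move=> mJ J1; rewrite mulrAC.
apply: ler_dist_Rintegral_slab => //;
  [exact: continuous_stretch|exact: continuous_stretch|exact: mulr_ge0|].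
move=> y _; apply: le_trans (fL _ _) _.
by rewrite opprD addrACA subrr addr0.
Qed.

(** The points [stretch t b y] and [stretch 0 b y] differ only by [t y_l] in the coordinate [l],
    with [|y_l| <= 1]. *)
Lemma face_approx (J : set (measurableTypeR R)) (b t : R) (x : 'rV[R]_n) :
  measurable J -> J `<=` `[- 1, 1]%classic -> 0 <= t ->
  `|\int[mu]_(y in slab J) f (x + stretch t b y) - face J b x|
     <= L * fine (mu (cube n (a + 1))) * t.
Proof.
move=> mJ J1 t0; rewrite mulrAC.
apply: ler_dist_Rintegral_slab => //;
  [exact: continuous_stretch|exact: continuous_stretch|exact: mulr_ge0|].
move=> y yJ; apply: le_trans (fL _ _) _; rewrite ler_wpM2l //.
rewrite opprD addrACA subrr add0r; apply: rV_norm_le => // j.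
have -> : (stretch t b y - stretch 0 b y) 0 j = if j == l then t * y 0 l else 0.
  by rewrite mxE [X in _ + X]mxE !stretchE; case: ifP => _; rewrite ?subrr// mul0r add0r addrK.
case: eqP => [_|_]; last by rewrite normr0.
have := yJ l; rewrite eqxx => /J1 /=; rewrite in_itv /= -ler_norml => yl.
by rewrite normrM (ger0_norm t0) -[leRHS]mulr1 ler_wpM2l.
Qed.

Definition cube_int x := \int[mu]_(y in cube n a) f (x + y).

(** The derivative of [cube_int] along axis [l]: what enters through one face minus what leaves
    through the other. The unit intervals are half-open like the slabs []a, a + t]] and [[-a, -a +
    t[] that they rescale. *)
Definition cube_partial x := face `]0, 1]%classic a x - face `[0, 1[%classic (- a) x.

Lemma cube_partial_lipschitz x x' :
  `|cube_partial x - cube_partial x'| <= 2 * L * fine (mu (cube n (a + 1))) * `|x - x'|.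
Proof.
have J1 : `]0, 1]%classic `<=` (`[-1, 1]%classic : set R).
  by apply: subset_itv; rewrite bnd_simp // lerN10.
have J2 : `[0, 1[%classic `<=` (`[-1, 1]%classic : set R).
  by apply: subset_itv; rewrite bnd_simp // lerN10.
have e1 := @face_lipschitz _ a x x' (measurable_itv _) J1.
have e2 := @face_lipschitz _ (- a) x x' (measurable_itv _) J2.
rewrite /cube_partial.
rewrite [X in `|X|](_ : _ = (face `]0, 1]%classic a x - face `]0, 1]%classic a x') -
  (face `[0, 1[%classic (- a) x - face `[0, 1[%classic (- a) x')); last by ring.
apply: le_trans (ler_normB _ _) _; apply: le_trans (lerD e1 e2) _.
by rewrite le_eqVlt; apply/orP; left; apply/eqP; ring.
Qed.

Lemma cube_int_partial_pos x t : 0 < t -> t <= 2 * a ->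
  `|cube_int (x + t *: delta_mx 0 l) - cube_int x - t * cube_partial x| <=
   2 * L * fine (mu (cube n (a + 1))) * t ^+ 2.
Proof.
move=> t0 ta.
(* In the direction [l]: the overlap of the cube and its translate, the part gained and the part
   lost. The overlap is nonempty because [t <= 2 a]. *)
pose I0 : set (measurableTypeR R) := `[- a + t, a]%classic.
pose Ip : set (measurableTypeR R) := `]a, a + t]%classic.
pose Im : set (measurableTypeR R) := `[- a, - a + t[%classic.
have mI0 : measurable I0 by exact: measurable_itv.
have mIp : measurable Ip by exact: measurable_itv.
have mIm : measurable Im by exact: measurable_itv.
(* All three intervals lie in [[-a, a + t]], and [a + t <= 3 a]. *)
have sub (I : interval R) : (forall s : R, s \in I -> - a <= s <= a + t)
  -> [set` I] `<=` (`[- (3 * a), 3 * a]%classic : set R).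
  by move=> H s /= /H; rewrite in_itv /= => /andP[s1 s2]; apply/andP; split; lra.
have sI0 : I0 `<=` `[- (3 * a), 3 * a]%classic.
  by apply: sub => s; rewrite in_itv /= => /andP[s1 s2]; apply/andP; split; lra.
have sIp : Ip `<=` `[- (3 * a), 3 * a]%classic.
  by apply: sub => s; rewrite in_itv /= => /andP[s1 s2]; apply/andP; split; lra.
have sIm : Im `<=` `[- (3 * a), 3 * a]%classic.
  by apply: sub => s; rewrite in_itv /= => /andP[s1 s2]; apply/andP; split; lra.
have J1 : `]0, 1]%classic `<=` (`[-1, 1]%classic : set R).
  by apply: subset_itv; rewrite bnd_simp // lerN10.
have J2 : `[0, 1[%classic `<=` (`[-1, 1]%classic : set R).
  by apply: subset_itv; rewrite bnd_simp // lerN10.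
have E1 : cube_int x = \int[mu]_(y in slab I0) f (x + y) + \int[mu]_(y in slab Im) f (x + y).
  rewrite -(Rintegral_slabU x mI0 mIm sI0 sIm); last first.
    by apply/disj_setPS => s; rewrite /I0 /Im /= !in_itv /= => -[/andP[s1 _] /andP[_]]; rewrite ltNge s1.
  rewrite /cube_int -slab_full; congr (Rintegral _ (slab _) _).
  apply/seteqP; split => s; rewrite /I0 /Im /= !in_itv /=.
    move=> /andP[s1 s2]; have [s3|s3] := leP (- a + t) s; first by left; rewrite s2.
    by right; rewrite s1.
  by move=> [] /andP[s1 s2]; apply/andP; split; lra.
have E2 : cube_int (x + t *: delta_mx 0 l)
  = \int[mu]_(y in slab I0) f (x + y) + \int[mu]_(y in slab Ip) f (x + y).
  rewrite -(Rintegral_slabU x mI0 mIp sI0 sIp); last first.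
    by apply/disj_setPS => s; rewrite /I0 /Ip /= !in_itv /= => -[/andP[_ s1] /andP[+ _]]; rewrite ltNge s1.
  transitivity (\int[mu]_(y in cube n a) f (x + (y + t *: delta_mx 0 l))).
    by apply: eq_Rintegral => y _; rewrite -addrA [y + _]addrC.
  have mC : measurable (cube n a) by apply: closed_measurable_rV; exact: closed_cube.
  rewrite (Rintegral_shift mC (@subset_refl _ _) (t *: delta_mx 0 l) (@continuous_shift x)).
  rewrite -slab_full slab_shift; congr (Rintegral _ (slab _) _).
  apply/seteqP; split => s; rewrite /I0 /Ip /= !in_itv /=.
    move=> /andP[s1 s2]; have [s3|s3] := leP s a; [left|right]; apply/andP; split; lra.
  by move=> [] /andP[s1 s2]; apply/andP; split; lra.
have Fp : \int[mu]_(y in slab Ip) f (x + y)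
  = t * \int[mu]_(y in slab `]0, 1]%classic) f (x + stretch t a y).
  apply: (Rintegral_slab_stretch _ t0 mIp (measurable_itv _) J1) => s.
  rewrite /Ip /= !in_itv /= ltrDr pmulr_rgt0 // [a + t]addrC lerD2r.
  by rewrite ger_pMr.
have Fm : \int[mu]_(y in slab Im) f (x + y)
  = t * \int[mu]_(y in slab `[0, 1[%classic) f (x + stretch t (- a) y).
  apply: (Rintegral_slab_stretch _ t0 mIm (measurable_itv _) J2) => s.
  rewrite /Im /= !in_itv /= lerDr pmulr_rge0 // [- a + t]addrC ltrD2r.
  by rewrite gtr_pMr.
have e1 := @face_approx _ a t x (measurable_itv _) J1 (ltW t0).
have e2 := @face_approx _ (- a) t x (measurable_itv _) J2 (ltW t0).
rewrite E1 E2 Fp Fm /cube_partial.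
set p := \int[mu]_(y in _) _ in e1 *; set q := \int[mu]_(y in _) _ in e2 *.
rewrite [X in `|X|](_ : _ = t * ((p - face `]0, 1]%classic a x) - (q - face `[0, 1[%classic (- a) x)));
  last by ring.
rewrite normrM (gtr0_norm t0).
apply: (@le_trans _ _ (t * (L * fine (mu (cube n (a + 1))) * t + L * fine (mu (cube n (a + 1))) * t))).
  by rewrite ler_wpM2l ?(ltW t0)//; apply: le_trans (ler_normB _ _) (lerD e1 e2).
by rewrite le_eqVlt; apply/orP; left; apply/eqP; ring.
Qed.

(** For negative [t] the positive case is applied backwards from the displaced point; moving the
    partial derivative back to [x] costs another [2 L K t^2], hence the constant 4. *)
Lemma cube_int_partial x t : `|t| <= 2 * a ->
  `|cube_int (x + t *: delta_mx 0 l) - cube_int x - t * cube_partial x| <=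
   4 * L * fine (mu (cube n (a + 1))) * t ^+ 2.
Proof.
set K := fine _ => ta.
have K0 : 0 <= L * K by rewrite mulr_ge0 // fine_ge0.
have [t0|t0|->] := ltgtP t 0; last 1 first.
- by rewrite scale0r addr0 subrr mul0r subr0 normr0 expr0n mulr0.
- set x' := x + t *: delta_mx 0 l.
  have t0' : 0 < - t by rewrite oppr_gt0.
  have := @cube_int_partial_pos x' (- t) t0'; rewrite scaleNr addrK sqrrN => e1.
  rewrite (ltr0_norm t0) in ta; have {}e1 := e1 ta.
  have e2 : `|cube_partial x' - cube_partial x| <= 2 * L * K * `|t|.
    apply: le_trans (cube_partial_lipschitz x' x) _.
    rewrite ler_wpM2l ?mulr_ge0 ?fine_ge0 // [x' - x]addrC addKr normrZ.
    by rewrite -[leRHS]mulr1 ler_wpM2l // norm_delta_rV.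
  have -> : cube_int x' - cube_int x - t * cube_partial x =
    - (cube_int x - cube_int x' - - t * cube_partial x') + t * (cube_partial x' - cube_partial x) by ring.
  apply: le_trans (ler_normD _ _) _; rewrite normrN.
  apply: le_trans (lerD e1 _) _.
    rewrite normrM; exact: ler_wpM2l e2.
  rewrite -/K -[t ^+ 2]real_normK ?num_real //.
  by have := sqr_ge0 `|t|; nra.
- rewrite (gtr0_norm t0) in ta; apply: le_trans (cube_int_partial_pos x t0 ta) _.
  rewrite ler_wpM2r ?sqr_ge0 // -/K; nra.
Qed.

End slab.

Lemma differentiable_cube_int (R : realType) (n : nat) (f : 'rV[R]_n -> R) (L a : R) (x : 'rV[R]_n) :
  0 <= L -> (forall x y, `|f x - f y| <= L * `|x - y|) -> 0 < a ->
  differentiable (cube_int f a) x.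
Proof.
move=> L0 fL a0; pose K := fine (lebesgue_rV R n (cube n (a + 1))).
have K0 : 0 <= K by rewrite fine_ge0.
apply: (@differentiable_lipschitz_partials R n _ (cube_partial f a) (4 * L * K) (2 * L * K) (2 * a)).
- by rewrite mulr_gt0.
- by rewrite !mulr_ge0.
- by rewrite !mulr_ge0.
- move=> j y t ta; exact: (@cube_int_partial R n f L a j L0 fL a0 y t ta).
- move=> j y z; exact: (@cube_partial_lipschitz R n f L a j L0 fL a0 y z).
Qed.

(** * A log-periodic staircase *)

Section log_staircase.
Context {R : realType}.
Implicit Types s t : R.

Definition log_wave s : R := (sin (ln s) + `|sin (ln s)|) / 2.

Lemma log_wave_ge0 s : 0 <= log_wave s.
Proof. by rewrite /log_wave; have := ler_norm (- sin (ln s)); rewrite normrN; lra. Qed.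

Lemma log_wave_ge_sin s : sin (ln s) <= log_wave s.
Proof. by rewrite /log_wave; have := ler_norm (sin (ln s)); lra. Qed.

Lemma log_wave_le1 s : log_wave s <= 1.
Proof.
rewrite /log_wave; have := sin_max (ln s); have := sin_le1 (ln s); lra.
Qed.

Lemma continuous_log_wave s : 0 < s -> {for s, continuous log_wave}.
Proof.
move=> s0.
have cs : {for s, continuous (fun s => sin (ln s))}.
  apply: (@continuous_comp _ _ _ (@ln R) (@sin R)); first exact: continuous_ln.
  exact: continuous_sin.
apply: cvgM; last exact: cvg_cst.
by apply: cvgD; [exact: cs|exact: (cvg_norm cs)].
Qed.

Lemma measurable_log_wave : measurable_fun [set: R] log_wave.
Proof.
have ms : measurable_fun [set: R] (fun s : R => sin (ln s)).
  apply: measurableT_comp; first exact: continuous_measurable_fun (@continuous_sin R).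
  exact: measurable_ln.
apply: measurable_funM => //; apply: measurable_funD => //.
exact: measurableT_comp.
Qed.

Definition log_stair s : R := \int[lebesgue_measure]_(t in `[0, s]) log_wave t.

Lemma lebesgue_measure_seg_lty s : (lebesgue_measure (`[0%R, s]%classic : set (measurableTypeR R)) < +oo)%E.
Proof.
rewrite [X in (X < _)%E](_ : _ = (if (0%:E < s%:E)%E then s%:E - 0%:E else 0)%E);
  last exact: lebesgue_measure_itv.
by case: ifP; rewrite ?ltry // -EFinB ltry.
Qed.

Lemma integrable_log_wave s : lebesgue_measure.-integrable `[0, s] (EFin \o log_wave).
Proof.
apply: measurable_bounded_integrable => //.
- exact: lebesgue_measure_seg_lty.
- exact: measurable_funTS measurable_log_wave.
- exists 1; split => // x x1 t _; apply: le_trans (ltW x1).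
  by rewrite ger0_norm ?log_wave_ge0 // log_wave_le1.
Qed.

Lemma log_stair_ge0 s : 0 <= log_stair s.
Proof. by apply: Rintegral_ge0 => t _; exact: log_wave_ge0. Qed.

Lemma log_stair_le s : 0 <= s -> log_stair s <= s.
Proof.
move=> s0.
apply: (@le_trans _ _ (\int[lebesgue_measure]_(t in `[0, s]) (1 : R))).
  apply: le_Rintegral => //; first exact: integrable_log_wave.
    apply: measurable_bounded_integrable => //; first exact: lebesgue_measure_seg_lty.
    by exists 1; split => // x x1 t _; rewrite normr1 ltW.
  by move=> t _; exact: log_wave_le1.
rewrite Rintegral_cst // mul1r.
rewrite [X in fine X](_ : _ = (if (0%:E < s%:E)%E then s%:E - 0%:E else 0)%E);
  last exact: lebesgue_measure_itv.
by rewrite lte_fin; case: ltP => _ //=; rewrite subr0.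
Qed.

Lemma is_derive_log_stair s : 0 < s -> is_derive s 1 log_stair (log_wave s).
Proof.
move=> s0.
have s1 : s < s + 1 by rewrite ltrDl.
have [d dE] := continuous_FTC1_closed s1 (integrable_log_wave (s + 1)) s0 (continuous_log_wave s0).
apply: DeriveDef; first exact: d.
rewrite -derive1E; exact: dE.
Qed.

Lemma log_stair_MVT s t (g dg : R -> R) : 0 < s -> s <= t ->
  (forall u : R, 0 < u -> is_derive u 1 g (dg u)) ->
  exists2 c, c \in `[s, t] & g t - g s = dg c * (t - s).
Proof.
move=> s0 st dG; apply: MVT_segment => //.
  by move=> x; rewrite in_itv /= => /andP[sx _]; apply: dG; exact: lt_trans sx.
apply: derivable_within_continuous => x; rewrite in_itv /= => /andP[sx _].
by have [] := dG x (lt_le_trans s0 sx).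
Qed.

(** The primitive of [sin (ln s)] that tends to [0] at [0]; it bounds the staircase from below in
    closed form. *)
Definition log_spiral s : R := s * (sin (ln s) - cos (ln s)) / 2.

Lemma is_derive_log_spiral s : 0 < s -> is_derive s 1 log_spiral (sin (ln s)).
Proof.
move=> s0.
have dl := is_derive1_ln s0.
have ds : is_derive s 1 (fun s => sin (ln s)) (cos (ln s) * s^-1).
  exact: (@is_derive1_comp _ (@sin R) (@ln R)).
have dc : is_derive s 1 (fun s => cos (ln s)) (- sin (ln s) * s^-1).
  exact: (@is_derive1_comp _ (@cos R) (@ln R)).
have -> : log_spiral = 2^-1 *: ((@id R) * ((fun s => sin (ln s)) - (fun s => cos (ln s)))).
  by apply/funext => t; rewrite /log_spiral mulrC.
apply: (is_derive_eq (is_deriveZ _ (is_deriveM (is_derive_id _ _) (is_deriveB ds dc)))).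
rewrite -[(_ - _) s]/(sin (ln s) - cos (ln s)) -![_ *: _]/(_ * _).
by field; rewrite gt_eqF.
Qed.

(** The difference is nondecreasing on the positive reals and its limit at [0] is [0]. As the
    derivatives are known only for positive arguments, the comparison starts at a small [u] and
    loses at most [e]. *)
Lemma log_stair_ge_spiral s : 0 < s -> log_spiral s <= log_stair s.
Proof.
move=> s0; rewrite -subr_ge0; apply/ler_addgt0Pr => e e0.
pose u := Num.min s (e / 2).
have u0 : 0 < u by rewrite lt_min s0 divr_gt0.
have us : u <= s by rewrite /u ge_min lexx.
have ue : u <= e / 2 by rewrite /u ge_min lexx orbT.
have dG (v : R) : 0 < v -> is_derive v 1 (log_stair - log_spiral) (log_wave v - sin (ln v)).
  by move=> v0; apply: is_deriveB; [exact: is_derive_log_stair|exact: is_derive_log_spiral].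
have [c _ E] := log_stair_MVT u0 us dG.
have : 0 <= (log_wave c - sin (ln c)) * (s - u).
  by rewrite mulr_ge0 ?subr_ge0 ?log_wave_ge_sin.
rewrite -E -[(_ - _) s]/(log_stair s - log_spiral s) -[(_ - _) u]/(log_stair u - log_spiral u).
have := log_stair_ge0 u.
have : log_spiral u <= u.
  rewrite /log_spiral; have := sin_le1 (ln u); have := cos_geN1 (ln u); nra.
lra.
Qed.

Lemma log_stair_homo s t : 0 < s -> s <= t -> log_stair s <= log_stair t.
Proof.
move=> s0 st; rewrite -subr_ge0.
have [c _ ->] := log_stair_MVT s0 st is_derive_log_stair.
by rewrite mulr_ge0 ?subr_ge0 ?log_wave_ge0.
Qed.

(* Among the four quarter turns of the angle ln s, one has sin - cos >= 1. *)
Lemma log_stair_ge s : 0 < s -> expR (- (2 * pi)) / 2 * s <= log_stair s.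
Proof.
move=> s0.
have key th : 0 <= th <= 2 * pi -> 1 <= sin (ln s - th) - cos (ln s - th) ->
    expR (- (2 * pi)) / 2 * s <= log_stair s.
  move=> /andP[th0 th1] H.
  (* The point below [s] whose angle [ln u] is [ln s - th]. There the spiral is at least [u / 2],
     and monotonicity carries this up to [s]. *)
  pose u := s * expR (- th).
  have u0 : 0 < u by rewrite mulr_gt0 ?expR_gt0.
  have us : u <= s by rewrite /u -[leRHS]mulr1 ler_wpM2l ?(ltW s0)// -expR0 ler_expR oppr_le0.
  apply: le_trans (log_stair_homo u0 us); apply: le_trans (log_stair_ge_spiral u0).
  rewrite /log_spiral /u lnM ?posrE ?expR_gt0 // expRK.
  have : expR (- (2 * pi)) <= expR (- th) :> R by rewrite ler_expR lerN2.
  move: (expR_gt0 (- (2 * pi) : R)) H; set e1 := expR _; set e2 := expR _; set c := (_ - _) => e10 H e12.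
  rewrite mulrAC ler_pM2r ?invr_gt0 // mulrC -mulrA ler_pM2l //; nra.
have p0 := pi_gt0 R.
set v := ln s in key *.
have c2 := cos2Dsin2 v.
have k0 := key 0; have k1 := key (pi / 2); have k2 := key pi; have k3 := key (pi + pi / 2).
rewrite subr0 in k0; rewrite sinBpihalf cosBpihalf in k1.
have E1 : sin (v - pi) = - sin v by rewrite -[v in RHS](subrK pi) sinDpi opprK.
have E2 : cos (v - pi) = - cos v by rewrite -[v in RHS](subrK pi) cosDpi opprK.
rewrite E1 E2 in k2; rewrite opprD addrA sinBpihalf cosBpihalf E1 E2 in k3.
have [h0|h0] := leP 1 (sin v - cos v); first by apply: k0 => //; apply/andP; split; lra.
have [h1|h1] := leP 1 (- cos v - sin v); first by apply: k1 => //; apply/andP; split; lra.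
have [h2|h2] := leP 1 (- sin v - - cos v); first by apply: k2 => //; apply/andP; split; lra.
have [h3|h3] := leP 1 (- - cos v - - sin v); first by apply: k3 => //; apply/andP; split; lra.
(* Otherwise [sin - cos] and [sin + cos] would both be less than 1 in absolute value, while their
   squares add up to 2. *)
nra.
Qed.

(** On such an interval [ln s] stays in a half turn where the sine is not positive. These are the
    flat steps that become regions of constancy. *)
Lemma log_wave_eq0 (i : nat) s :
  expR (- (pi *+ (2 * i).+1)) < s < expR (- (pi *+ (2 * i))) -> log_wave s = 0.
Proof.
move=> /andP[s1 s2].
have s0 : 0 < s by apply: lt_trans s1; exact: expR_gt0.
have l1 : - (pi *+ (2 * i).+1) < ln s by rewrite -ltr_expR lnK ?posrE.
have l2 : ln s < - (pi *+ (2 * i)) by rewrite -ltr_expR lnK ?posrE.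
rewrite /log_wave.
suff : sin (ln s) <= 0 by move=> h; rewrite ler0_norm // subrr mul0r.
rewrite -(periodicn (@sinD2pi R) i) -mulrnA -oppr_ge0 -sinN.
apply: sin_ge0_pi; move: l1 l2; rewrite mulrS; move: (pi *+ (2 * i)) => u.
by move=> l1 l2; apply/andP; split; lra.
Qed.

End log_staircase.

(** * A member of the class Xi made of cubes *)



Section cube_geometry.
Context {R : realType} {n : nat}.
Implicit Types p q : R.

Lemma convex_cube p : @convex_set R 'rV[R]_n (cube n p).
Proof.
move=> x y t; rewrite !inE /cube /= => xp yp.
apply: le_trans (ler_normD _ _) _; rewrite !normrZ.
rewrite ger0_norm // ger0_norm ?subr_ge0 //.
have t1 : t%:num <= 1 by [].
have t0 : 0 <= t%:num by [].
rewrite -[leRHS](_ : t%:num * p + (1 - t%:num) * p = p); last by ring.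
by apply: lerD; rewrite ler_wpM2l // subr_ge0.
Qed.

Lemma cube0 p : 0 <= p -> cube n p 0.
Proof. by rewrite /cube /= normr0. Qed.

Lemma excess_cube_le p q : 0 <= p -> 0 <= q -> excess (cube n p) (cube n q) <= n%:R * `|p - q|.
Proof.
move=> p0 q0; apply: ge_sup; first by exists (dist_set 0 (cube n q)); exists 0 => //; exact: cube0.
move=> _ [a ap <-].
have lb : has_lbound [set enorm (a - b) | b in cube n q].
  by exists 0 => _ [b _ <-]; exact: enorm_ge0.
have [aq|qa] := leP `|a| q.
  apply: (@le_trans _ _ 0); last by rewrite mulr_ge0.
  by apply: ge_inf => //; exists a => //; rewrite subrr enorm0.
have a0 : 0 < `|a| by exact: le_lt_trans qa.
(* Radial projection of [a] onto the smaller cube. *)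
pose b := (q / `|a|) *: a.
apply: (@le_trans _ _ (enorm (a - b))).
  apply: ge_inf => //; exists b => //.
  by rewrite /cube /= normrZ ger0_norm ?divr_ge0 // divfK ?gt_eqF.
apply: le_trans (enorm_le_norm _) _; rewrite ler_wpM2l //.
rewrite /b -[X in X - _]scale1r -scalerBl normrZ ger0_norm; last first.
  by rewrite subr_ge0 ler_pdivrMr // mul1r ltW.
rewrite mulrBl mul1r divfK ?gt_eqF //.
apply: le_trans (ler_norm _); rewrite lerD2r; exact: ap.
Qed.

Lemma excess_cube_ge0 p q : 0 <= p -> 0 <= q -> 0 <= excess (cube n p) (cube n q).
Proof.
move=> p0 q0.
have d0 (a : 'rV[R]_n) : 0 <= dist_set a (cube n q).
  apply: lb_le_inf; first by exists (enorm (a - 0)); exists 0 => //; exact: cube0.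
  by move=> _ [b _ <-]; exact: enorm_ge0.
apply: le_trans (d0 0) _; apply: ub_le_sup; last by exists 0 => //; exact: cube0.
(* An upper bound is required for the supremum to dominate its elements; comparing with the point
   [0] of the other cube gives one. *)
exists (n%:R * p) => _ [a ap <-].
apply: (@le_trans _ _ (enorm (a - 0))).
  apply: ge_inf; last by exists 0 => //; exact: cube0.
  by exists 0 => _ [b _ <-]; exact: enorm_ge0.
rewrite subr0; apply: le_trans (enorm_le_norm _) _; rewrite ler_wpM2l //.
Qed.

Lemma hausdorff_dist_cube_le p q : 0 <= p -> 0 <= q ->
  hausdorff_dist (cube n p) (cube n q) <= n%:R * `|p - q|.
Proof.
move=> p0 q0; rewrite /hausdorff_dist ge_max excess_cube_le //= distrC.
exact: excess_cube_le.
Qed.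

Lemma hausdorff_dist_cube_ge0 p q : 0 <= p -> 0 <= q ->
  0 <= hausdorff_dist (cube n p) (cube n q).
Proof. by move=> p0 q0; rewrite /hausdorff_dist le_max excess_cube_ge0. Qed.

Lemma diameter_cube_ub p : ubound [set enorm (z.1 - z.2) | z in cube n p `*` cube n p] (n%:R * (2 * p)).
Proof.
move=> _ [[a b] /= [ap bp] <-].
apply: le_trans (enorm_le_norm _) _; rewrite ler_wpM2l //.
apply: le_trans (ler_normB _ _) _.
by rewrite mulr_natl mulr2n lerD.
Qed.

Lemma diameter_cube_le p : 0 <= p -> diameter (cube n p) <= n%:R * (2 * p).
Proof.
move=> p0; apply: ge_sup; last exact: diameter_cube_ub.
by exists (enorm (0 - 0 : 'rV[R]_n)); exists (0, 0) => //; split; exact: cube0.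
Qed.

Lemma diameter_cube_ge0 p : 0 <= p -> 0 <= diameter (cube n p).
Proof.
move=> p0; apply: ub_le_sup; first by exists (n%:R * (2 * p)); exact: diameter_cube_ub.
by exists (0, 0); [split; exact: cube0|rewrite /= subr0 enorm0].
Qed.

Lemma interior_cube p : (cube n.+1 p)° = [set v : 'rV[R]_n.+1 | `|v| < p].
Proof.
apply/seteqP; split => v; last first.
  move=> /= vp.
  apply: (@filterS _ _ _ (fun w : 'rV[R]_n.+1 => `|w| < p)); first by move=> w; exact: ltW.
  exact: (@cvgr_lt _ _ (nbhs v) _ _ _ (@norm_continuous _ _ v)).
move=> /nbhs_normP[e /= e0 H].
(* Moving [v] outwards along its own unit direction must stay in the cube for a while, which forces
   [|v| < p]. At [v = 0] a direction is supplied by the positive dimension. *)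
have [d d1 vd] : exists2 d : 'rV[R]_n.+1, `|d| = 1 & v = `|v| *: d.
  have [->|v0] := eqVneq v 0.
    exists (const_mx 1); last by rewrite normr0 scale0r.
    apply/eqP; rewrite eq_le; apply/andP; split.
      by apply: rV_norm_le => // i; rewrite mxE normr1.
    by have := rV_coord_le_norm (const_mx 1 : 'rV[R]_n.+1) ord0; rewrite mxE normr1.
  exists (`|v|^-1 *: v).
    by rewrite normrZ normfV normr_id mulVf // normr_eq0.
  by rewrite scalerA divff ?scale1r // normr_eq0.
have e20 : 0 < e / 2 by rewrite divr_gt0.
have : cube n.+1 p (v + (e / 2) *: d).
  apply: H; rewrite /= opprD addrA subrr add0r normrN normrZ d1 mulr1 gtr0_norm //.
  by rewrite ltr_pdivrMr // ltr_pMr // ltr1n.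
rewrite {1}vd -scalerDl /cube /= normrZ d1 mulr1 ger0_norm ?addr_ge0 ?(ltW e20) //.
by apply: lt_le_trans; rewrite ltrDl.
Qed.

(** [C1_boundary] asks for the Euclidean sphere as parameter space; dividing by the sup norm maps it
    radially onto the surface of the cube. *)
Lemma boundary_cube p : 0 < p ->
  boundary (cube n.+1 p) = (fun u => p *: (`|u|^-1 *: u)) @` [set u : 'rV[R]_n.+1 | enorm u = 1].
Proof.
move=> p0; rewrite /boundary interior_cube -(closure_id _).1; last exact: closed_cube.
apply/seteqP; split => v.
  move=> [vp /negP]; rewrite -leNgt => pv.
  have {pv vp}vp : `|v| = p by apply/eqP; rewrite eq_le pv andbT.
  have v0 : v != 0 by rewrite -normr_gt0 vp.
  have ev : 0 < enorm v by rewrite enorm_gt0.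
  exists ((enorm v)^-1 *: v).
    by rewrite /= enormZ ger0_norm ?invr_ge0 ?ltW// mulVf ?gt_eqF.
  rewrite /= normrZ ger0_norm ?invr_ge0 ?ltW// !scalerA vp.
  by rewrite (_ : _ * _ = 1) ?scale1r//; field; rewrite !gt_eqF.
move=> [u /= u1 <-].
have u0 : 0 < `|u| by rewrite normr_gt0 -enorm_gt0 u1.
have : `|p *: (`|u|^-1 *: u)| = p.
  by rewrite !normrZ normfV normr_id mulVf ?gt_eqF// mulr1 gtr0_norm.
by rewrite /cube /= => ->; split => //; rewrite ltxx.
Qed.

End cube_geometry.

Lemma is_derive_coord_rV (R : realType) (n : nat) (x v : 'rV[R]_n) (i : 'I_n) :
  is_derive x v (fun z : 'rV[R]_n => z 0 i : R) (v 0 i).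
Proof.
have dc := differentiable_coord x 0 i.
apply: DeriveDef; first exact: diff_derivable.
rewrite deriveE //.
have @f : {linear 'rV[R]_n -> R}.
  by exists (fun N : 'rV[R]_n => N 0 i); do 2![eexists]; do ?[constructor];
     rewrite ?mxE// => ? *; rewrite ?mxE//; move=> ?; rewrite !mxE.
rewrite (_ : (fun _ => _) = f) // diff_lin //.
exact: coord_continuous.
Qed.

(** * Cubes whose half-side depends on the distance to the centre *)

Section radial_cubes.
Context {R : realType} {n : nat}.
Variables (rho drho : R -> R) (C : R) (x0 : 'rV[R]_n.+1).
Hypotheses (rho_ge0 : forall s, 0 <= rho s) (rho_le : forall s, 0 <= s -> rho s <= C * s)
  (rho_gt : forall s, 0 < s -> s < rho s)
  (is_derive_rho : forall s : R, 0 < s -> is_derive s 1 rho (drho s))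
  (continuous_drho : forall s : R, 0 < s -> {for s, continuous drho}).

Definition cube_radius (x : 'rV[R]_n.+1) : R := rho (enorm (x - x0)).
Definition radial_cube (x : 'rV[R]_n.+1) : set 'rV[R]_n.+1 := cube n.+1 (cube_radius x).

Lemma cube_radius_center : cube_radius x0 = 0.
Proof.
apply/eqP; rewrite eq_le rho_ge0 andbT /cube_radius subrr enorm0.
by rewrite -[leRHS](mulr0 C) rho_le.
Qed.

Lemma enorm_sub_gt0 (x : 'rV[R]_n.+1) : x != x0 -> 0 < enorm (x - x0).
Proof. by rewrite enorm_gt0 subr_eq0. Qed.

Lemma continuous_rho (s : R) : 0 < s -> {for s, continuous rho}.
Proof.
move=> s0; apply: differentiable_continuous; apply/derivable1_diffP.
by have [] := is_derive_rho s0.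
Qed.

Lemma continuous_cube_radius : continuous cube_radius.
Proof.
move=> x; have cx := @continuous_enorm_dist R _ x0 x.
(* At the centre [rho] has no derivative to rely on: continuity comes from the squeeze
   [0 <= rho s <= C s]. *)
have [->|xx0] := eqVneq x x0; last first.
  apply: (@continuous_comp _ _ _ (fun z : 'rV[R]_n.+1 => enorm (z - x0)) rho) => //.
  by apply: continuous_rho; exact: enorm_sub_gt0.
rewrite /continuous_at cube_radius_center.
have c0 : C * enorm (z - x0) @[z --> x0] --> (0 : R).
  rewrite -[X in _ --> X](mulr0 C) -(@enorm0 R n.+1) -(subrr x0).
  apply: (@cvgM _ _ (nbhs x0)); first exact: cvg_cst.
  exact: continuous_enorm_dist.
apply: (@squeeze_cvgr _ (nbhs x0) _ _ (fun=> 0) (fun z => C * enorm (z - x0)) cube_radius _ 0) => //;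
  last exact: cvg_cst.
by apply: nearW => z; rewrite rho_ge0 /= rho_le // enorm_ge0.
Qed.

(** The radius is factored as [(rho \o Num.sqrt) \o sqdist]: a function of one variable after a
    polynomial, so the Euclidean norm is never differentiated by itself. *)
Lemma is_derive_rho_sqrt (t : R) : 0 < t ->
  is_derive t 1 (rho \o Num.sqrt) (drho (Num.sqrt t) * (2 * Num.sqrt t)^-1).
Proof.
move=> t0; apply: (@is_derive1_comp _ rho (@Num.sqrt R)).
  by apply: is_derive_rho; rewrite sqrtr_gt0.
exact: is_derive1_sqrt.
Qed.

Definition sqdist (z : 'rV[R]_n.+1) : R := \sum_i (z - x0) 0 i ^+ 2.

Lemma sqdistE : sqdist = \sum_i ((fun z : 'rV[R]_n.+1 => z 0 i - x0 0 i) * (fun z => z 0 i - x0 0 i)).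
Proof. by apply/funext => z; rewrite fct_sumE; apply: eq_bigr => i _; rewrite !mxE expr2. Qed.

Lemma differentiable_sqdist (x : 'rV[R]_n.+1) : differentiable sqdist x.
Proof.
rewrite sqdistE; apply: differentiable_sum => i.
have dc : differentiable (fun z : 'rV[R]_n.+1 => z 0 i - x0 0 i) x.
  apply: (@differentiableB _ _ _ (fun z : 'rV[R]_n.+1 => z 0 i : R^o)); last exact: differentiable_cst.
  exact: differentiable_coord.
exact: differentiableM.
Qed.

Lemma diff_sqdist (x v : 'rV[R]_n.+1) : 'd sqdist x v = 2 * \sum_i (x - x0) 0 i * v 0 i.
Proof.
rewrite -deriveE; last exact: differentiable_sqdist.
have dcoord i : is_derive x v (fun z : 'rV[R]_n.+1 => z 0 i - x0 0 i) (v 0 i).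
  rewrite -[v 0 i]subr0; apply: (@is_deriveB _ _ _ (fun z : 'rV[R]_n.+1 => z 0 i : R) (cst (x0 0 i))).
  exact: is_derive_coord_rV.
have := @is_derive_sum _ _ _ _ _ x v _ (fun i => is_deriveM (dcoord i) (dcoord i)).
rewrite -sqdistE => ds; rewrite (@derive_val _ _ _ _ _ _ _ ds) mulr_sumr.
by apply: eq_bigr => i _; rewrite -[_ *: _]/(_ * _) !mxE; ring.
Qed.

Lemma differentiable_cube_radius x : x != x0 -> differentiable cube_radius x.
Proof.
move=> xx0; have -> : cube_radius = (rho \o Num.sqrt) \o sqdist by [].
apply: differentiable_comp; first exact: differentiable_sqdist.
apply/derivable1_diffP.
have s0 : 0 < sqdist x by rewrite -sqrtr_gt0; exact: enorm_sub_gt0.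
by have [] := is_derive_rho_sqrt s0.
Qed.

Lemma diff_cube_radius x v : x != x0 ->
  'd cube_radius x v = drho (enorm (x - x0)) / enorm (x - x0) * \sum_i (x - x0) 0 i * v 0 i.
Proof.
move=> xx0; have E : cube_radius = (rho \o Num.sqrt) \o sqdist by [].
have s0 : 0 < sqdist x by rewrite -sqrtr_gt0; exact: enorm_sub_gt0.
have ds := is_derive_rho_sqrt s0.
have dd : differentiable (rho \o Num.sqrt) (sqdist x).
  by apply/derivable1_diffP; have [] := ds.
rewrite E diff_comp //; last exact: differentiable_sqdist.
rewrite /= diff_sqdist deriv1E; last by have [] := ds.
rewrite derive1E (@derive_val _ _ _ _ _ _ _ ds) -[_ *: _]/(_ * _).
rewrite -/(enorm (x - x0)); field.
by rewrite gt_eqF // enorm_sub_gt0.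
Qed.

Definition boundary_param (x u : 'rV[R]_n.+1) : 'rV[R]_n.+1 := cube_radius x *: (`|u|^-1 *: u).

Lemma differentiable_boundary_param x u : x != x0 -> differentiable (fun z => boundary_param z u) x.
Proof. by move=> xx0; apply: differentiableZl; exact: differentiable_cube_radius. Qed.

(** Only the scalar radius depends on [x], so the Jacobian has rank at most one: the gradient of the
    radius times the direction of [u]. Its continuity in both variables is then visible
    entrywise. *)
Lemma jacobian_boundary_param x u : x != x0 ->
  'J (fun z => boundary_param z u) x =
  \matrix_(i, j) (drho (enorm (x - x0)) / enorm (x - x0) * (x - x0) 0 i * (`|u|^-1 * u 0 j)).
Proof.
move=> xx0; apply/matrixP => i j; rewrite /jacobian mxE.
rewrite [RHS]mxE /boundary_param diffZl; last exact: differentiable_cube_radius.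
rewrite mxE diff_cube_radius // (_ : \sum_k _ = (x - x0) 0 i).
  by congr (_ * _); rewrite mxE.
rewrite (bigD1 i) //= [delta_mx _ _ _ _]mxE !eqxx mulr1 big1 ?addr0 // => k ki.
by rewrite [delta_mx _ _ _ _]mxE (negPf ki) andbF mulr0.
Qed.

Lemma C1_boundary_radial_cube (S : set 'rV[R]_n.+1) : C1_boundary S x0 radial_cube.
Proof.
exists boundary_param.
have sph0 (u : 'rV[R]_n.+1) : enorm u = 1 -> 0 < `|u|.
  by move=> u1; rewrite normr_gt0 -enorm_gt0 u1.
have rad0 x : x != x0 -> 0 < cube_radius x.
  by move=> xx0; apply: lt_trans (rho_gt _); exact: enorm_sub_gt0.
have cu (p : 'rV[R]_n.+1 * 'rV[R]_n.+1) : enorm p.2 = 1 ->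
    `|q.2|^-1 @[q --> p] --> `|p.2|^-1.
  move=> p1; apply: (@cvgV _ _ (nbhs p)); first by rewrite gt_eqF // sph0.
  by apply: (@cvg_norm _ _ _ (nbhs p)); exact: cvg_snd.
split.
- by move=> x [_ xx0]; rewrite /radial_cube boundary_cube // rad0.
- apply: continuous_in_subspaceT => p; rewrite inE => -[[_ xx0] p1].
  apply: (@cvgZ _ _ _ (nbhs p)).
    by apply: (@continuous_comp _ _ _ fst cube_radius); [exact: cvg_fst|exact: continuous_cube_radius].
  by apply: (@cvgZ _ _ _ (nbhs p)); [exact: cu|exact: cvg_snd].
- by move=> x u [_ xx0] _; exact: differentiable_boundary_param.
- pose J (p : 'rV[R]_n.+1 * 'rV[R]_n.+1) : 'M[R]_n.+1 := \matrix_(i, j)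
    (drho (enorm (p.1 - x0)) / enorm (p.1 - x0) * (p.1 - x0) 0 i * (`|p.2|^-1 * p.2 0 j)).
  apply: (@subspace_eq_continuous _ _ _ J).
    by move=> p; rewrite inE => -[[_ xx0] _]; exact/esym/jacobian_boundary_param.
  apply: continuous_in_subspaceT => p; rewrite inE => -[[_ xx0] p1].
  apply: (@cvg_matrix _ _ (nbhs p)) => i j.
  rewrite [X in _ --> X]mxE; under eq_cvg do rewrite mxE.
  have s0 := enorm_sub_gt0 xx0.
  have cs : {for p, continuous (fun p : 'rV[R]_n.+1 * 'rV[R]_n.+1 => enorm (p.1 - x0))}.
    by apply: (@continuous_comp _ _ _ fst (fun z : 'rV[R]_n.+1 => enorm (z - x0)));
      [exact: cvg_fst|exact: continuous_enorm_dist].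
  apply: (@cvgM _ _ (nbhs p)).
    apply: (@cvgM _ _ (nbhs p)).
      apply: (@cvgM _ _ (nbhs p)).
        by apply: (@continuous_comp _ _ _ (fun p : 'rV[R]_n.+1 * 'rV[R]_n.+1 => enorm (p.1 - x0)) drho) => //; exact: continuous_drho.
      by apply: (@cvgV _ _ (nbhs p)) => //; rewrite gt_eqF.
    apply: (@continuous_comp _ _ _ (fun p : 'rV[R]_n.+1 * 'rV[R]_n.+1 => p.1 - x0)
      (fun z : 'rV[R]_n.+1 => z 0 i)).
      by apply: (@cvgB _ _ _ (nbhs p)); [exact: cvg_fst|exact: cvg_cst].
    exact: coord_continuous.
  apply: (@cvgM _ _ (nbhs p)); first exact: cu.
  by apply: (@continuous_comp _ _ _ snd (fun z : 'rV[R]_n.+1 => z 0 j));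
    [exact: cvg_snd|exact: coord_continuous].
Qed.

End radial_cubes.

(** * The staircase radius as a member of the class *)

Section witness.
Context {R : realType} {n : nat}.
Variables (S : set 'rV[R]_n.+1) (x0 : 'rV[R]_n.+1).

(** Since [log_stair s] is at least [exp (-2 pi) s / 2], this factor gives a radius of at least
    [2 s], hence greater than [s]. *)
Definition witness_slope : R := 4 * expR (2 * pi).

Definition witness_radius (s : R) : R := witness_slope * log_stair s.

(** The zeros of [sin (ln s)] in []0, 1]]: the sine is negative between the indices [2 i + 1] and
    [2 i]. *)
Definition witness_eps (i : nat) : R := expR (- (pi *+ i)).

Let D := radial_cube witness_radius x0.

Lemma witness_slope_gt0 : 0 < witness_slope.
Proof. by rewrite mulr_gt0 // expR_gt0. Qed.

Lemma witness_radius_ge0 s : 0 <= witness_radius s.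
Proof. by rewrite mulr_ge0 ?log_stair_ge0 // ltW // witness_slope_gt0. Qed.

Lemma witness_radius_le s : 0 <= s -> witness_radius s <= witness_slope * s.
Proof. by move=> s0; rewrite ler_wpM2l ?log_stair_le // ltW // witness_slope_gt0. Qed.

Lemma witness_radius_gt s : 0 < s -> s < witness_radius s.
Proof.
move=> s0.
have : witness_slope * (expR (- (2 * pi)) / 2 * s) <= witness_radius s.
  by rewrite ler_wpM2l ?log_stair_ge // ltW // witness_slope_gt0.
apply: lt_le_trans.
rewrite /witness_slope (_ : _ * _ = 2 * (expR (2 * pi) * expR (- (2 * pi))) * s); last by field.
rewrite -expRD subrr expR0; lra.
Qed.

Lemma is_derive_witness_radius (s : R) : 0 < s ->
  is_derive s 1 witness_radius (witness_slope * log_wave s).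
Proof.
by move=> s0; apply: (@is_deriveZ _ _ _ log_stair witness_slope); exact: is_derive_log_stair.
Qed.

Lemma continuous_derive_witness_radius (s : R) : 0 < s ->
  {for s, continuous (fun s => witness_slope * log_wave s)}.
Proof.
by move=> s0; apply: cvgM; [exact: cvg_cst|exact: continuous_log_wave].
Qed.

Lemma witness_radius_cst i s t :
  witness_eps (2 * i).+1 < s < witness_eps (2 * i) ->
  witness_eps (2 * i).+1 < t < witness_eps (2 * i) ->
  witness_radius s = witness_radius t.
Proof.
wlog st : s t / s <= t => [H si ti|].
  by have [/H|/ltW /H] := leP s t; [exact|move=> /(_ ti si)].
move=> /andP[s1 s2] /andP[t1 t2]; rewrite /witness_radius; congr (_ * _).
have s0 : 0 < s by apply: lt_trans s1; exact: expR_gt0.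
have [c] := log_stair_MVT s0 st (@is_derive_log_stair R).
rewrite in_itv /= => /andP[c1 c2].
rewrite (@log_wave_eq0 _ i) ?mul0r; last by rewrite (lt_le_trans s1 c1) (le_lt_trans c2 t2).
by move=> /eqP; rewrite subr_eq0 => /eqP.
Qed.

Lemma Xi_witness : Xi S x0 D witness_eps.
Proof.
have rg0 := witness_radius_ge0.
have rle := witness_radius_le.
have crad := continuous_cube_radius rg0 rle is_derive_witness_radius (x0 := x0).
have diam x : diameter (D x) <= (n.+1%:R * (2 * witness_slope)) * enorm (x - x0).
  apply: le_trans (diameter_cube_le (rg0 _)) _.
  rewrite -[leRHS]mulrA ler_wpM2l // -[leRHS](mulrA 2 witness_slope) ler_wpM2l //.
  exact: (rle _ (enorm_ge0 (x - x0))).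
split.
- by move=> x; exists 0; apply: cube0; exact: rg0.
- by move=> x; exact: convex_cube.
- by move=> x; exact: compact_cube.
- move=> x.
  have c0 : n.+1%:R * `|cube_radius witness_radius x0 z - cube_radius witness_radius x0 x| @[z --> x] --> (0 : R).
    rewrite -[X in _ --> X](mulr0 (n.+1%:R : R)) -(@normr0 _ R) -(subrr (cube_radius witness_radius x0 x)).
    apply: (@cvgM _ _ (nbhs x)); first exact: cvg_cst.
    apply: (@cvg_norm _ _ _ (nbhs x)); apply: (@cvgB _ _ _ (nbhs x)); last exact: cvg_cst.
    exact: crad.
  apply: (@squeeze_cvgr _ (nbhs x) _ _ (fun=> 0) _ (fun z => hausdorff_dist (D z) (D x)) _ 0 _ c0) => //;
    last exact: cvg_cst.
  by apply: nearW => z; rewrite hausdorff_dist_cube_ge0 ?hausdorff_dist_cube_le; try exact: rg0.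
- move=> x _ xx0.
  have xs : `|x - x0| < cube_radius witness_radius x0 x.
    apply: le_lt_trans (norm_le_enorm _) _; apply: witness_radius_gt.
    by rewrite enorm_gt0 subr_eq0.
  (* The sup norm of [x - x0] is at most the Euclidean one, hence less than the radius; the gap is
     the size of a neighbourhood of [x0] inside [x + D x]. *)
  have r0 : 0 < cube_radius witness_radius x0 x - `|x - x0| by rewrite subr_gt0.
  have F0 : Filter (nbhs x0) by exact: nbhs_filter.
  have := @cvgr_dist_lt _ _ _ (nbhs x0) F0 id x0 cvg_id _ r0.
  apply: (@filterS _ (nbhs x0) F0).
  move=> z /= zx; exists (z - x); last by rewrite addrC subrK.
  rewrite /D /radial_cube /cube /=.
  have -> : z - x = - (x0 - z) - (x - x0) by rewrite opprB opprB addrA subrK.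
  apply: le_trans (ler_normB _ _) _; rewrite normrN; lra.
- have c0 : (n.+1%:R * (2 * witness_slope)) * enorm (z - x0) @[z --> x0] --> (0 : R).
    rewrite -[X in _ --> X](mulr0 (n.+1%:R * (2 * witness_slope))) -(@enorm0 R n.+1) -(subrr x0).
    apply: (@cvgM _ _ (nbhs x0)); first exact: cvg_cst.
    exact: continuous_enorm_dist.
  apply: cvg_within_filter.
  apply: (@squeeze_cvgr _ (nbhs x0) _ _ (fun=> 0) (fun z => (n.+1%:R * (2 * witness_slope)) * enorm (z - x0)) (fun x => diameter (D x)) _ 0) => //; last exact: cvg_cst.
  by apply: nearW => z; rewrite diam andbT; apply: diameter_cube_ge0; exact: rg0.
- by exists (n.+1%:R * (2 * witness_slope)).
- by move=> i; exact: expR_gt0.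
- have -> : witness_eps = GRing.exp (expR (- pi)).
    by apply/funext => i; rewrite /witness_eps -expRM_natl mulr_natl mulNrn.
  apply: cvg_expr; rewrite ger0_norm ?expR_ge0 // expR_lt1 oppr_lt0; exact: pi_gt0.
- move=> i x y rx ry; rewrite /D /radial_cube /cube_radius; by rewrite (witness_radius_cst rx ry).
- exact: (@C1_boundary_radial_cube R n witness_radius (fun s => witness_slope * log_wave s)
    witness_slope x0 rg0 rle witness_radius_gt is_derive_witness_radius
    continuous_derive_witness_radius S).
Qed.

End witness.

(** * Conclusion *)



Lemma convex_hull1 (R : realType) (n : nat) (v : 'rV[R]_n) : convex_hull [set v] = [set v].
Proof. by apply: smallest_id; exact: convex_set1. Qed.

Lemma convex_hull_sub1 (R : realType) (n : nat) (A : set 'rV[R]_n) (v : 'rV[R]_n) :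
  A `<=` [set v] -> convex_hull A `<=` [set v].
Proof. by move=> Av; apply: smallest_sub => //; exact: convex_set1. Qed.

Section gradient_limit.
Context {R : realType} {n : nat}.
Variables (S : set 'rV[R]_n.+1) (f : 'rV[R]_n.+1 -> R) (x0 : 'rV[R]_n.+1).
Hypotheses (Sx0 : nbhs x0 S) (cf : continuous f) (df : differentiable f x0).

(** Convergence, and not just identification of possible limits: the same fact gives the inclusion
    in the singleton and, on the witness sequence, the membership. *)
Lemma cvg_gradient_mean_value D eps (x : nat -> 'rV[R]_n.+1) : Xi S x0 D eps ->
  (forall j, exists i, region x0 eps i (x j)) ->
  (forall j, differentiable (mean_value f D) (x j)) ->
  x j @[j --> \oo] --> x0 ->
  gradient (mean_value f D) (x j) @[j --> \oo] --> gradient f x0.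
Proof.
move=> XiD rx dx xx0; apply/cvgrPdist_le => e e0.
have [d d0 H] := gradient_mean_value XiD Sx0 cf df e0.
have := @cvgr_dist_lt _ _ _ _ eventually_filter x x0 xx0 _ d0.
apply: filterS => j xj; have [i ri] := rx j.
by rewrite distrC (H i) // distrC.
Qed.

Lemma dphi_sub D eps : Xi S x0 D eps -> dphi f x0 D eps `<=` [set gradient f x0].
Proof.
move=> XiD; apply: convex_hull_sub1 => v [x [rx dx xx0 gv]].
have gf := cvg_gradient_mean_value XiD rx dx xx0.
exact: (cvg_unique (@norm_hausdorff _ 'rV[R]_n.+1) gv gf).
Qed.

End gradient_limit.

(** * A sequence that realizes the gradient *)

Section witness_point.
Context {R : realType} {n : nat}.
Variable (x0 : 'rV[R]_n.+1).
Let D := radial_cube (@witness_radius R) x0.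

(** On the logarithmic scale this is the middle of the region of index [j], which runs from
    [-(2 j + 1) pi] to [-2 j pi]. *)
Definition witness_point (j : nat) : 'rV[R]_n.+1 :=
  x0 + expR (- (pi *+ (2 * j)) - pi / 2) *: delta_mx 0 ord0.

Lemma enorm_witness_point j :
  enorm (witness_point j - x0) = expR (- (pi *+ (2 * j)) - pi / 2).
Proof.
rewrite /witness_point addrC addKr enormZ ger0_norm ?expR_ge0 //.
rewrite /enorm (bigD1 ord0) //= big1 ?addr0; last first.
  by move=> i i0; rewrite mxE eqxx (negPf i0) expr0n.
by rewrite mxE !eqxx expr1n sqrtr1 mulr1.
Qed.

Lemma region_witness_point j : region x0 (@witness_eps R) j (witness_point j).
Proof.
rewrite /region /= enorm_witness_point /witness_eps !ltr_expR mulrS.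
have := pi_gt0 R; move: (pi *+ _) => u p0.
by apply/andP; split; lra.
Qed.

Lemma cvg_witness_point : witness_point j @[j --> \oo] --> x0.
Proof.
rewrite -[X in _ --> X]addr0 -(scale0r (delta_mx 0 ord0 : 'rV[R]_n.+1)).
apply: cvgD; first exact: cvg_cst.
apply: cvgZr_tmp.
have ce : (@witness_eps R) j @[j --> \oo] --> (0 : R) := Xi_eps_cvg (Xi_witness setT x0).
apply: (@squeeze_cvgr _ _ _ _ (fun=> 0) (@witness_eps R) _ _ 0) => //; last exact: cvg_cst.
apply: nearW => j; rewrite expR_ge0 /= ler_expR mul2n -addnn mulrnDr.
have : 0 <= pi *+ j :> R by rewrite mulrn_wge0 // ltW // pi_gt0.
by have := pi_gt0 R; lra.
Qed.

(** Near the point the body is one fixed cube, so the mean coincides locally with a multiple of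
    [cube_int]. *)
Lemma differentiable_witness_mean (f : 'rV[R]_n.+1 -> R) j : lipschitz_rV f ->
  differentiable (mean_value f D) (witness_point j).
Proof.
move=> /lipschitz_rV_norm[L L0 fL].
set a := cube_radius (@witness_radius R) x0 (witness_point j).
have a0 : 0 < a.
  apply: le_lt_trans (witness_radius_gt _); rewrite ?enorm_ge0 //.
  by rewrite enorm_witness_point expR_gt0.
have XiD := Xi_witness setT x0.
apply: (@near_eq_differentiable _ _ _ ((fine (lebesgue_rV R n.+1 (cube n.+1 a)))^-1 *: cube_int f a)).
  by apply: differentiableZ; exact: differentiable_cube_int L0 fL a0.
have := near_region (region_witness_point j).
apply: filterS => z rz.
have E : D z = cube n.+1 a := Xi_constant XiD rz (region_witness_point j).
by rewrite /mean_value E.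
Qed.

End witness_point.

Theorem theorem2p1 (R : realType) (n : nat) (S : set 'rV[R]_n.+1)
    (f : 'rV[R]_n.+1 -> R) (x0 : 'rV[R]_n.+1) :
  nbhs x0 S -> lipschitz_rV f -> differentiable f x0 ->
  Phi S f x0 = [set gradient f x0].
Proof.
move=> Sx0 lf df.
have cf : continuous f.
  by have [L L0 fL] := lipschitz_rV_norm lf; exact: lipschitz_norm_continuous L0 fL.
(* The union itself is already the singleton, so the outer hulls are compared through their
   generators. *)
rewrite /Phi -[RHS]convex_hull1; congr convex_hull.
apply/seteqP; split.
  by move=> v [[D eps] /= XiD]; exact: (dphi_sub Sx0 cf df XiD).
move=> _ ->; exists (radial_cube (@witness_radius R) x0, @witness_eps R) => /=.
  exact: Xi_witness.
apply: sub_gen_smallest; exists (witness_point x0).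
have rx j : exists i, region x0 (@witness_eps R) i (witness_point x0 j).
  by exists j; exact: region_witness_point.
have dx j := @differentiable_witness_mean R n x0 f j lf.
split => //; first exact: cvg_witness_point.
apply: (cvg_gradient_mean_value Sx0 cf df (Xi_witness S x0) rx dx).
exact: cvg_witness_point.
Qed.
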